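(* Let $n\in\mathbb{N}$, $n\geq 1$, and let $\mathcal{S}$ be an irreducible norm closed semigroup of complex $n\times n$ matrices. Then the following conditions are equivalent. (i) $\mathcal{S}$ is simultaneously similar to a semigroup of partial isometries, i.e. there is an invertible complex $n\times n$ matrix $S$ such that $S^{-1}TS$ is a partial isometry for every $T\in\mathcal{S}$; (ii) the idempotent members of $\mathcal{S}$ all commute with each other, and $\sigma(T)\subseteq\{0\}\cup\mathbb{T}$ for all $T\in\mathcal{S}$; (iii) the idempotent members of $\mathcal{S}$ all commute with each other, and there exist real numbers $c_1,c_2>0$ such that $c_1\le\|T\|\le c_2$ for all nonzero $T\in\mathcal{S}$.
   Context: $\mathbb{C}^n$ carries its standard inner product and the corresponding norm; for a complex $n\times n$ matrix $T$, $\|T\|=\sup\{\|Tx\| : x\in\mathbb{C}^n,\ \|x\|\le 1\}$ is the operator norm, $\sigma(T)$ is the spectrum (set of complex eigenvalues), and $T^*$ is the adjoint (conjugate transpose). $\mathbb{T}=\{z\in\mathbb{C} : |z|=1\}$ is the unit circle. A semigroup of $n\times n$ matrices is a set of matrices closed under matrix multiplication (it need not contain the identity, nor the zero matrix). It is norm closed if it is a closed subset of the space of all complex $n\times n$ matrices with the operator norm. It is irreducible if the only linear subspaces of $\mathbb{C}^n$ invariant under every member of the semigroup are $\{0\}$ and $\mathbb{C}^n$. A matrix $T$ is a partial isometry if both $T^*T$ and $TT^*$ are self-adjoint projections (i.e. matrices $Q$ with $Q=Q^2=Q^*$). A matrix $P$ is idempotent if $P^2=P$ (self-adjointness is not required).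 *)

(* Defs.v *)
From HB Require Import structures.
From mathcomp Require Import all_boot all_order all_algebra.
From mathcomp Require Import spectral.
From mathcomp Require Import complex.
From mathcomp Require Import all_classical all_reals.

Set Implicit Arguments.
Unset Strict Implicit.
Unset Printing Implicit Defensive.

Import Order.TTheory GRing.Theory Num.Theory.

(* Matrices act on column vectors, and R[i] is the field of complex numbers
   over the real numbers R. *)

Local Open Scope ring_scope.
Local Open Scope classical_set_scope.
Local Open Scope sesquilinear_scope.
Local Open Scope complex_scope.

Section Definitions.
Context {R : realType} {n : nat}.
Implicit Types (T P Q : 'M[R[i]]_n) (x y : 'cV[R[i]]_n) (SS : set 'M[R[i]]_n).

Definition inner x y : R[i] := (y ^t* *m x) 0 0.

(* [inner x x] is a nonnegative real, so its real part is [inner x x] as an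
   element of R. *)
Definition vnorm x : R := Num.sqrt (complex.Re (inner x x)).

Definition opnorm T : R :=
  sup [set vnorm (T *m x) | x in [set x | vnorm x <= 1]].

(* [eigenvalue T z] says that T - z%:M has a nonzero kernel on row vectors; for
   a square matrix this is the non-invertibility of T - z%:M, so left and right
   eigenvalues agree. *)
Definition spectrum T : set R[i] := [set z | eigenvalue T z].

Definition matrix_semigroup SS : Prop :=
  forall A B, SS A -> SS B -> SS (A *m B).

(* SS contains all its adherent points for the metric opnorm (A - B). *)
Definition norm_closed SS : Prop :=
  forall T, (forall e : R, 0 < e -> exists2 A, SS A & opnorm (A - T) < e) ->
    SS T.

Definition invariant SS (V : {vspace 'cV[R[i]]_n}) : Prop :=
  forall T, SS T -> forall x, x \in V -> T *m x \in V.

Definition irreducible SS : Prop :=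
  forall V : {vspace 'cV[R[i]]_n}, invariant SS V -> V = 0%VS \/ V = fullv.

Definition selfadjoint_projection Q : Prop := Q *m Q = Q /\ Q ^t* = Q.

Definition partial_isometry T : Prop :=
  selfadjoint_projection (T ^t* *m T) /\ selfadjoint_projection (T *m T ^t*).

Definition idempotent_mx P : Prop := P *m P = P.

Definition idempotents_commute SS : Prop :=
  forall P Q, SS P -> SS Q -> idempotent_mx P -> idempotent_mx Q ->
    P *m Q = Q *m P.

End Definitions.

(* Main.v *)
Require Import Defs.
From mathcomp Require Import all_boot all_order all_algebra.
From mathcomp Require Import perm complex spectral.
From mathcomp Require Import all_classical all_reals.
From mathcomp Require Import topology normedtype sequences.
From mathcomp Require Import ring.

(** Why the theorem holds: (i) implies (ii), (ii) implies (iii) and (iii)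
    implies (i).

    From (i) to (ii).  Idempotent partial isometries are orthogonal
    projections, and two orthogonal projections whose product is a partial
    isometry commute.  For the spectrum, let T be a matrix all of whose powers
    are partial isometries and let N be a power of T whose rank does not drop
    on squaring.  Then the range of N is also its initial space, so N preserves
    the length of an eigenvector of T for a nonzero eigenvalue, which therefore
    has modulus one ([power_pisom_eigenvalue]).

    From (ii) to (iii).  The trace form is nondegenerate on the linear span of
    an irreducible semigroup ([trace_form_nondegenerate]).  All members have
    trace at most n in modulus, so the semigroup is bounded: otherwise its
    members, rescaled to norm one, would accumulate at a nonzero matrix of the
    span that is orthogonal to the semigroup for the trace form.  By the same
    nondegeneracy every nonzero member T has a product T B of nonzero trace;
    T B has an eigenvalue of modulus one, and this keeps the norm of T away
    from zero.

    From (iii) to (i).  Let r be the least rank of a nonzero member.  If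
    A = P Q is a member of rank r, factored through dimension r, then the
    matrices Q T P with T in the semigroup are zero or invertible, and
    compactness makes the invertible ones a bounded group containing the
    identity.  Hence A T A = A for some member T ([regular]), so there are
    idempotents of rank r on both sides of A.  These minimal idempotents commute,
    hence are pairwise orthogonal and finite in number, and by irreducibility
    they add up to the identity.  With respect to the resulting decomposition of
    the space each member is a partial permutation of blocks, every nonzero block
    being invertible.  The group of one corner preserves a positive definite form
    ([unitarizable]): among the matrices Z for which every Z A is a contraction,
    A in the group, take one of largest |det Z|.  Members of the semigroup
    transport this form from one range to all others, and for the orthogonal sum
    of the transported forms every member is a partial isometry
    ([similar_to_pisom]).

    Compactness is used through limits along one ultrafilter on the natural
    numbers, along which every bounded sequence converges. *)

Set Implicit Arguments.
Unset Strict Implicit.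
Unset Printing Implicit Defensive.

Import Order.TTheory GRing.Theory Num.Theory.
Import numFieldNormedType.Exports.

Local Open Scope ring_scope.
Local Open Scope classical_set_scope.
Local Open Scope sesquilinear_scope.
Local Open Scope complex_scope.

Local Notation Re := complex.Re.
Local Notation Im := complex.Im.

(** * Limits along an ultrafilter *)

Section UltraLimits.
Variables (U : set_system nat) (UF : UltraFilter U).
#[local] Instance UP : ProperFilter U := ultra_proper.

(** A one-constructor inductive rather than an alias of convergence: the
    filter inclusion underneath would otherwise unfold during unification and
    when implicit arguments are computed. *)
Variant slim (K : numFieldType) (u : nat -> K) (l : K) : Prop :=
  Slim of u @ U --> l.

Section Scalar.
Variable K : numFieldType.
Implicit Types (u v : nat -> K) (l m : K).

Lemma slim_ext u v l : u =1 v -> slim u l -> slim v l.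
Proof. by move=> /funext ->. Qed.

Lemma slim_near u v l : U [set k | u k = v k] -> slim u l -> slim v l.
Proof.
move=> uv [ul]; constructor; apply: cvg_trans ul.
by apply: near_eq_cvg.
Qed.

Lemma slim_cst l : slim (fun=> l) l.
Proof. by constructor; exact: cvg_cst. Qed.

Lemma slimD u v l m : slim u l -> slim v m -> slim (fun k => u k + v k) (l + m).
Proof. by move=> [?] [?]; constructor; exact: cvgD. Qed.

Lemma slimM u v l m : slim u l -> slim v m -> slim (fun k => u k * v k) (l * m).
Proof. by move=> [?] [?]; constructor; exact: cvgM. Qed.

Lemma slimN u l : slim u l -> slim (fun k => - u k) (- l).
Proof. by move=> [?]; constructor; exact: cvgN. Qed.

Lemma slim_norm u l : slim u l -> slim (fun k => `|u k|) `|l|.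
Proof. by move=> [?]; constructor; exact: cvg_norm. Qed.

Lemma slim_of_cvg u l : \oo `<=` U -> u @ \oo --> l -> slim u l.
Proof.
by move=> Uoo ul; constructor; apply: cvg_trans ul; apply: cvg_fmap2 => A; exact: Uoo.
Qed.

Lemma slim_uniq u l m : slim u l -> slim u m -> l = m.
Proof. by move=> [ul] [um]; apply: cvg_unique ul um; exact: norm_hausdorff. Qed.

Lemma slim_sum (I : Type) (s : seq I) (P : pred I) (u : I -> nat -> K) (l : I -> K) :
  (forall i, slim (u i) (l i)) ->
  slim (fun k => \sum_(i <- s | P i) u i k) (\sum_(i <- s | P i) l i).
Proof.
move=> ul; constructor; apply: cvg_big => [|i _]; [exact: add_continuous|by case: (ul i)].
Qed.

Lemma slim_prod (I : Type) (s : seq I) (P : pred I) (u : I -> nat -> K) (l : I -> K) :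
  (forall i, slim (u i) (l i)) ->
  slim (fun k => \prod_(i <- s | P i) u i k) (\prod_(i <- s | P i) l i).
Proof.
move=> ul; constructor; apply: cvg_big => [|i _]; [exact: mul_continuous|by case: (ul i)].
Qed.

(** Stated for numeric fields, where the order is only partial: a limit of
    nonnegative numbers equals its own absolute value. *)
Lemma slim_le u v l m : slim u l -> slim v m -> (forall k, u k <= v k) -> l <= m.
Proof.
move=> ul vm uv; rewrite -subr_ge0.
have d := slimD vm (slimN ul).
have := slim_norm d; rewrite (_ : (fun k => _) = (fun k => v k - u k)).
  by move=> d'; rewrite (slim_uniq d d').
by apply/funext => k; rewrite ger0_norm // subr_ge0.
Qed.

Lemma slimP u l :
  slim u l <-> forall e : K, 0 < e -> U [set k | `|l - u k| < e].
Proof. by split=> [[/cvgrPdist_lt]//|ul]; constructor; apply/cvgrPdist_lt. Qed.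

Lemma slim_eps u l (e : K) : slim u l -> 0 < e -> exists k, `|u k - l| < e.
Proof.
move=> ul e0; have [k /= ue] := filter_ex ((slimP u l).1 ul e e0).
by exists k; rewrite distrC.
Qed.
End Scalar.

(** The cluster point given by compactness of the segment is a limit, since
    an ultrafilter contains every set or its complement. *)
Lemma slim_exists_real (R : realType) (u : nat -> R) (c : R) :
  (forall k, `|u k| <= c) -> exists l, slim u l.
Proof.
move=> uc; have [|l [_ cl]] := @segment_compact R (- c) c (u @ U) _.
  by apply: (@filterE _ U) => k; rewrite /= in_itv /= -ler_norml.
exists l; apply/slimP => e e0.
have [//|far] := in_ultra_setVsetC [set k | `|l - u k| < e] UF.
have [x [[]]] := cl (u @` ~` [set k | `|l - u k| < e]) _
  (filterS (@preimage_image _ _ u _) far) (nbhsx_ballx l e e0).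
by move=> k kf <-.
Qed.

Lemma slim_embed (R : realType) (u : nat -> R) (l : R) :
  slim u l -> slim (fun k => (u k)%:C) l%:C.
Proof.
move=> ul; apply/slimP => e e0.
have eE : (Re e)%:C = e by rewrite RRe_real // gtr0_real.
have e0' : 0 < Re e by rewrite -ltcR eE.
have ue := (slimP u l).1 ul _ e0'.
apply: filterS ue => k /= uk; rewrite -eE -rmorphB /= normc_def /=.
by rewrite expr0n addr0 sqrtr_sqr ltcR.
Qed.

Lemma slim_exists (R : realType) (u : nat -> R[i]) (c : R[i]) :
  (forall k, `|u k| <= c) -> exists l, slim u l.
Proof.
move=> uc.
have cE : (Re c)%:C = c by rewrite RRe_real // ger0_real // (le_trans _ (uc 0)).
have [|a ua] := @slim_exists_real R (fun k => Re (u k)) (Re c).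
  move=> k; rewrite -lecR cE; apply: le_trans (uc k); exact: normc_ge_Re.
have [|b ub] := @slim_exists_real R (fun k => Im (u k)) (Re c).
  move=> k; rewrite -lecR cE; apply: le_trans (uc k).
  have i1 : `|'i%C : R[i]| = 1 by rewrite normc_def /= expr0n expr1n add0r sqrtr1.
  by have := normc_ge_Re (u k * 'i%C); rewrite ReiNIm normrN normrM i1 mulr1.
exists (a%:C + 'i%C * b%:C).
have H := slimD (slim_embed ua) (slimM (slim_cst 'i%C) (slim_embed ub)).
apply: slim_ext H.
by move=> k /=; rewrite -complexE.
Qed.

Section Matrices.
Variable R : realType.
Notation C := R[i].

Variant mlim p q (A : nat -> 'M[C]_(p, q)) (L : 'M[C]_(p, q)) : Prop :=
  Mlim of forall i j, slim (fun k => A k i j) (L i j).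

Lemma mlim_exists p q (A : nat -> 'M[C]_(p, q)) (c : C) :
  (forall k i j, `|A k i j| <= c) -> exists L, mlim A L.
Proof.
move=> Ac.
have /choice[l ll] : forall ij : 'I_p * 'I_q, exists l, slim (fun k => A k ij.1 ij.2) l.
  by move=> ij; apply: (@slim_exists R _ c) => k; exact: Ac.
exists (\matrix_(i, j) l (i, j)); constructor=> i j; rewrite mxE; exact: (ll (i, j)).
Qed.

Lemma mlim_ext p q (A B : nat -> 'M[C]_(p, q)) L : A =1 B -> mlim A L -> mlim B L.
Proof. by move=> /funext ->. Qed.

Lemma mlim_near p q (A B : nat -> 'M[C]_(p, q)) L :
  U [set k | A k = B k] -> mlim A L -> mlim B L.
Proof.
move=> AB [AL]; constructor=> i j.
by apply: slim_near (AL i j); apply: filterS AB => k /= ->.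
Qed.

Lemma mlim_cst p q (L : 'M[C]_(p, q)) : mlim (fun=> L) L.
Proof. by constructor=> i j; exact: slim_cst. Qed.

Lemma mlimM p q s (A : nat -> 'M[C]_(p, q)) (B : nat -> 'M[C]_(q, s)) L M :
  mlim A L -> mlim B M -> mlim (fun k => A k *m B k) (L *m M).
Proof.
move=> [AL] [BM]; constructor=> i j; rewrite mxE.
apply: (@slim_ext _ (fun k => \sum_m A k i m * B k m j)); first by move=> k; rewrite mxE.
by apply: slim_sum => m; exact: slimM.
Qed.

Lemma mlim_uniq p q (A : nat -> 'M[C]_(p, q)) L M : mlim A L -> mlim A M -> L = M.
Proof. by move=> [AL] [AM]; apply/matrixP => i j; exact: slim_uniq (AL i j) (AM i j). Qed.

Lemma slim_det p (A : nat -> 'M[C]_p) L :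
  mlim A L -> slim (fun k => \det (A k)) (\det L).
Proof.
move=> [AL]; apply: slim_sum => s; apply: slimM; first exact: slim_cst.
by apply: slim_prod => i; exact: AL.
Qed.

Lemma slim_trace p (A : nat -> 'M[C]_p) L :
  mlim A L -> slim (fun k => \tr (A k)) (\tr L).
Proof. by move=> [AL]; apply: slim_sum => i; exact: AL. Qed.
End Matrices.
End UltraLimits.

(** * The entrywise norm and the operator norm *)

Section EntryNorm.
Variable C : numClosedFieldType.

(** The sum of the moduli of the entries, valued in the field itself so that
    its bounds can be used without leaving the order of the complex numbers. *)
Definition mxnorm1 p q (A : 'M[C]_(p, q)) : C := \sum_i \sum_j `|A i j|.

Lemma mxnorm1_ge0 p q (A : 'M[C]_(p, q)) : 0 <= mxnorm1 A.
Proof. by apply: sumr_ge0 => i _; apply: sumr_ge0. Qed.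

Lemma entry_le_mxnorm1 p q (A : 'M[C]_(p, q)) i j : `|A i j| <= mxnorm1 A.
Proof.
rewrite /mxnorm1 (bigD1 i) //= (bigD1 j) //= -addrA lerDl addr_ge0 //.
  by apply: sumr_ge0.
by apply: sumr_ge0 => k _; apply: sumr_ge0.
Qed.

Lemma mxnorm1_eq0 p q (A : 'M[C]_(p, q)) : mxnorm1 A = 0 -> A = 0.
Proof.
move=> A0; apply/matrixP => i j; rewrite mxE; apply/eqP.
by rewrite -normr_le0 -A0 entry_le_mxnorm1.
Qed.

Lemma mxnorm1_0 p q : mxnorm1 (0 : 'M[C]_(p, q)) = 0.
Proof. by apply: big1 => i _; apply: big1 => j _; rewrite mxE normr0. Qed.

Lemma mxnorm1_gt0 p q (A : 'M[C]_(p, q)) : A <> 0 -> 0 < mxnorm1 A.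
Proof. by move=> A0; rewrite lt0r mxnorm1_ge0 andbT; apply/eqP => /mxnorm1_eq0. Qed.

Lemma mxnorm1_le p q (A : 'M[C]_(p, q)) c :
  (forall i j, `|A i j| <= c) -> mxnorm1 A <= (p * q)%:R * c.
Proof.
move=> Ac; have : mxnorm1 A <= \sum_(i < p) \sum_(j < q) c.
  by apply: ler_sum => i _; apply: ler_sum => j _.
by under eq_bigr do rewrite sumr_const card_ord; rewrite sumr_const card_ord
  -!mulrnA mulnC mulr_natl.
Qed.

Lemma mxnorm1Z p q a (A : 'M[C]_(p, q)) : mxnorm1 (a *: A) = `|a| * mxnorm1 A.
Proof.
rewrite mulr_sumr; apply: eq_bigr => i _; rewrite mulr_sumr.
by apply: eq_bigr => j _; rewrite mxE normrM.
Qed.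

Lemma mxnorm1M p q s (A : 'M[C]_(p, q)) (B : 'M[C]_(q, s)) :
  mxnorm1 (A *m B) <= mxnorm1 A * mxnorm1 B.
Proof.
have : mxnorm1 (A *m B) <= \sum_i \sum_k \sum_j `|A i j| * `|B j k|.
  apply: ler_sum => i _; apply: ler_sum => k _; rewrite mxE.
  by apply: (le_trans (ler_norm_sum _ _ _)); apply: ler_sum => j _; rewrite normrM.
move=> /le_trans; apply; rewrite mulr_suml; apply: ler_sum => i _.
rewrite exchange_big mulr_suml /=; apply: ler_sum => j _.
rewrite -mulr_sumr; apply: ler_wpM2l => //.
rewrite /mxnorm1 [leRHS](bigD1 j) //= lerDl.
by apply: sumr_ge0 => k _; apply: sumr_ge0.
Qed.

Lemma sum_sqr_le (I : finType) (a : I -> C) :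
  (forall i, 0 <= a i) -> \sum_i a i ^+ 2 <= (\sum_i a i) ^+ 2.
Proof.
move=> a0; rewrite [leRHS]expr2 mulr_suml; apply: ler_sum => i _.
rewrite expr2 ler_wpM2l // (bigD1 i) //= lerDl.
by apply: sumr_ge0 => k _.
Qed.
End EntryNorm.

Section OperatorNorm.
Variables (R : realType).
Notation C := R[i].

Lemma vnorm_sqr n (x : 'cV[C]_n) : (vnorm x)%:C ^+ 2 = \sum_i `|x i 0| ^+ 2.
Proof.
have xx : inner x x = \sum_i `|x i 0| ^+ 2.
  by rewrite /inner mxE; apply: eq_bigr => i _; rewrite !mxE normCKC.
have xx0 : 0 <= inner x x by rewrite xx sumr_ge0 // => i _; rewrite exprn_ge0.
rewrite -rmorphXn /= sqr_sqrtr; last by rewrite -ler0c RRe_real // ger0_real.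
by rewrite RRe_real ?ger0_real.
Qed.

Lemma vnorm_ge0 n (x : 'cV[C]_n) : 0 <= vnorm x.
Proof. exact: sqrtr_ge0. Qed.

Lemma coord_le_vnorm n (x : 'cV[C]_n) i : `|x i 0| <= (vnorm x)%:C.
Proof.
rewrite -(@ler_pXn2r _ 2) // ?nnegrE ?normr_ge0 ?ler0c ?vnorm_ge0 ?mxnorm1_ge0 // vnorm_sqr.
rewrite (bigD1 i) //= lerDl; apply: sumr_ge0 => j _; exact: exprn_ge0.
Qed.

Lemma vnorm_le_mxnorm1 n (x : 'cV[C]_n) : (vnorm x)%:C <= mxnorm1 x.
Proof.
rewrite -(@ler_pXn2r _ 2) // ?nnegrE ?ler0c ?vnorm_ge0 ?mxnorm1_ge0 // vnorm_sqr.
rewrite /mxnorm1; under [X in _ <= X ^+ 2]eq_bigr do rewrite big_ord1.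
exact: sum_sqr_le.
Qed.

Lemma vnorm_mul_le n (T : 'M[C]_n) (x : 'cV[C]_n) :
  vnorm x <= 1 -> (vnorm (T *m x))%:C <= mxnorm1 T.
Proof.
move=> x1; apply: le_trans (vnorm_le_mxnorm1 _) _.
apply: ler_sum => i _; rewrite big_ord1 mxE.
apply: (le_trans (ler_norm_sum _ _ _)); apply: ler_sum => j _.
rewrite normrM ler_piMr // (le_trans (coord_le_vnorm _ _)) //.
by rewrite -[1]/(1%:C) lecR.
Qed.

Lemma opnorm_le_mxnorm1 n (T : 'M[C]_n) : (opnorm T)%:C <= mxnorm1 T.
Proof.
have NE : (Re (mxnorm1 T))%:C = mxnorm1 T by rewrite RRe_real // ger0_real // mxnorm1_ge0.
rewrite -NE lecR; apply: ge_sup.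
  exists (vnorm (T *m 0)), 0 => //=.
  by rewrite -lecR (le_trans (vnorm_le_mxnorm1 _)) // mxnorm1_0 ler0c.
by move=> _ [x /= x1 <-]; rewrite -lecR NE; exact: vnorm_mul_le.
Qed.

Lemma entry_le_opnorm n (T : 'M[C]_n) i j : `|T i j| <= (opnorm T)%:C.
Proof.
have NE : (Re (mxnorm1 T))%:C = mxnorm1 T by rewrite RRe_real // ger0_real // mxnorm1_ge0.
have -> : T i j = (T *m delta_mx j 0 : 'cV_n) i 0.
  by rewrite mxE (bigD1 j) //= mxE !eqxx mulr1 big1 ?addr0 // => k /negbTE kj;
     rewrite mxE kj mulr0.
apply: le_trans (coord_le_vnorm _ _) _; rewrite lecR; apply: ub_le_sup.
  exists (Re (mxnorm1 T)) => _ [x /= x1 <-]; rewrite -lecR NE; exact: vnorm_mul_le.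
exists (delta_mx j 0) => //=.
rewrite -lecR -(@ler_pXn2r _ 2) // ?nnegrE ?ler0c ?vnorm_ge0 // vnorm_sqr expr1n.
rewrite (bigD1 j) //= mxE !eqxx normr1 expr1n big1 ?addr0 // => k /negbTE kj.
by rewrite mxE kj normr0 expr0n.
Qed.
End OperatorNorm.

(** * Powers, factorizations and the trace form *)

Section Powers.
Variables (K : fieldType).

(** The (k+1)-st power.  The shift avoids the identity, which need not lie in
    the semigroup, and iteration of the product makes sense in every dimension,
    0 included. *)
Definition mxpow n (T : 'M[K]_n) k := iter k (mulmx T) T.

Lemma mxpowS n (T : 'M[K]_n) k : mxpow T k.+1 = T *m mxpow T k.
Proof. by []. Qed.

Lemma mxpowD n (T : 'M[K]_n) j k : mxpow T j *m mxpow T k = mxpow T (j + k).+1.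
Proof. by elim: j => [|j IH] //; rewrite !mxpowS -mulmxA IH. Qed.

Lemma mxpowSr n (T : 'M[K]_n) k : mxpow T k.+1 = mxpow T k *m T.
Proof. by have := mxpowD T k 0; rewrite addn0. Qed.

Lemma mxpow_factor n r (U : 'M[K]_(n, r)) (W : 'M[K]_(r, n)) k :
  mxpow (U *m W) k *m U = U *m mxpow (W *m U) k.
Proof.
elim: k => [|k IH]; first by rewrite /= mulmxA.
by rewrite !mxpowS -mulmxA IH !mulmxA.
Qed.

(** Powers of U W and of W U have equal traces although the two matrices may
    have different sizes. *)
Lemma mxtrace_mxpowC n r (U : 'M[K]_(n, r)) (W : 'M[K]_(r, n)) k :
  \tr (mxpow (U *m W) k) = \tr (mxpow (W *m U) k).
Proof.
case: k => [|k]; first by rewrite /= mxtrace_mulC.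
by rewrite mxpowSr mulmxA mxpow_factor mxtrace_mulC mulmxA.
Qed.

Lemma mxpow_exp n (T : 'M[K]_n.+1) k : mxpow T k = T ^+ k.+1.
Proof.
elim: k => [|k IH]; first by rewrite expr1.
by rewrite mxpowS IH [RHS]exprS.
Qed.

Lemma mxpow_unit n (T : 'M[K]_n) k : T \in unitmx -> mxpow T k \in unitmx.
Proof. by move=> Tu; elim: k => [//|k IH]; rewrite mxpowS unitmx_mul Tu. Qed.

Lemma det_mxpow n (T : 'M[K]_n) k : \det (mxpow T k) = \det T ^+ k.+1.
Proof.
elim: k => [|k IH]; first by rewrite expr1.
by rewrite mxpowS det_mulmx IH [RHS]exprS.
Qed.

End Powers.

Section Sandwich.
Variable K : fieldType.

Lemma mxrank_sandwich n r s (U : 'M[K]_(n, r)) (M : 'M[K]_(r, s)) m (V : 'M[K]_(s, m)) :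
  row_full U -> row_free V -> \rank (U *m M *m V) = \rank M.
Proof. by move=> Uf Vf; rewrite mxrankMfree // (eqmxMfull _ Uf). Qed.

Lemma sandwich_eq0 n r s (U : 'M[K]_(n, r)) (M : 'M[K]_(r, s)) m (V : 'M[K]_(s, m)) :
  row_full U -> row_free V -> U *m M *m V = 0 -> M = 0.
Proof.
by move=> Uf Vf e; apply/eqP; rewrite -mxrank_eq0 -(mxrank_sandwich M Uf Vf) e mxrank0.
Qed.

Lemma sandwich_inj n r s (U : 'M[K]_(n, r)) (M N : 'M[K]_(r, s)) m (V : 'M[K]_(s, m)) :
  row_full U -> row_free V -> U *m M *m V = U *m N *m V -> M = N.
Proof.
move=> Uf Vf /eqP; rewrite -subr_eq0 -mulmxBl -mulmxBr => /eqP.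
by move=> /(sandwich_eq0 Uf Vf)/eqP; rewrite subr_eq0 => /eqP.
Qed.

Lemma full_rank_factor n m (A : 'M[K]_(n, m)) :
  exists r (U : 'M[K]_(n, r)) (V : 'M[K]_(r, m)),
    [/\ A = U *m V, r = \rank A, row_full U & row_free V].
Proof.
exists (\rank A), (col_base A), (row_base A).
by rewrite mulmx_base col_base_full row_base_free.
Qed.
End Sandwich.

Section Span.
Variables (K : numFieldType) (n : nat) (SS : set 'M[K]_n).

(** Taking traces in the Cayley-Hamilton identity leaves only the constant
    term, the determinant up to sign, times the trace of the identity. *)
Lemma mxtrace_pow_unit r (M : 'M[K]_r) :
  M \in unitmx -> (forall k, \tr (mxpow M k) = 0) -> r = 0%N.
Proof.
case: r M => // r M Mu trM.
have := congr1 mxtrace (Cayley_Hamilton M); rewrite linear0.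
set p := char_poly M; rewrite -[p]coefK poly_def rmorph_sum /= linear_sum /=.
have sp : size p = r.+2 by rewrite size_char_poly.
rewrite sp big_ord_recl big1 ?addr0 => [|i _].
  rewrite linearZ /= rmorph1 linearZ /= mxtrace1 => /eqP; rewrite mulf_eq0.
  rewrite pnatr_eq0 orbF /p char_poly_det mulf_eq0 signr_eq0 /=.
  by move: Mu; rewrite unitmxE unitfE => /negbTE ->.
rewrite linearZ /= linearZ /= rmorphXn /= horner_mx_X.
by rewrite -mxpow_exp trM mulr0.
Qed.

(** [matrix_semigroup] speaks of matrices over R[i] only, while the algebra
    below is done over abstract fields. *)
Definition mxsemigroup := forall A B, SS A -> SS B -> SS (A *m B).

(** The linear span, described as the double orthogonal for the trace form.
    In this form it is visibly closed under limits. *)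
Definition inspan (X : 'M[K]_n) : Prop :=
  forall D, (forall T, SS T -> \tr (D *m T) = 0) -> \tr (D *m X) = 0.

Lemma inspan_mem T : SS T -> inspan T.
Proof. by move=> ST D; apply. Qed.

Lemma inspanM X Y : mxsemigroup -> inspan X -> inspan Y -> inspan (X *m Y).
Proof.
move=> sgS SX SY D D0; rewrite mulmxA; apply: SY => T ST.
rewrite mxtrace_mulC mulmxA; apply: SX => T' ST'.
by rewrite -mulmxA mxtrace_mulC -mulmxA; apply: D0; exact: sgS.
Qed.

Lemma inspan_mxpow X k : mxsemigroup -> inspan X -> inspan (mxpow X k).
Proof.
by move=> sgS SX; elim: k => [//|k IH]; rewrite mxpowS; exact: inspanM.
Qed.

(** Induction on the rank.  If X has least rank among nonzero elements of the
    radical of the trace form and X B X is nonzero, then X B X, which is again in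
    the radical, has the rank of X; so X B is invertible on the range of X while all
    its powers have trace zero, which is impossible in characteristic zero. *)
Lemma trace_form_nondegenerate X :
  mxsemigroup ->
  (forall X Z : 'M_n, X <> 0 -> Z <> 0 -> exists2 B, SS B & X *m B *m Z <> 0) ->
  inspan X -> (forall T, SS T -> \tr (X *m T) = 0) -> X = 0.
Proof.
move=> sgS sep; move: {2}(\rank X) (leqnn (\rank X)) => r.
elim: r X => [|r IH] X rX SX trX.
  by apply/eqP; rewrite -mxrank_eq0 -leqn0.
apply: contrapT => X0; have [B SB XBX0] := sep _ _ X0 X0.
have SXB : inspan (X *m B) by apply: inspanM => //; exact: inspan_mem.
have rXBX : (\rank X <= \rank (X *m B *m X))%N.
  rewrite leqNgt; apply/negP => lt; apply: XBX0; apply: IH.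
  - by rewrite -ltnS (leq_trans lt).
  - exact: inspanM.
  - move=> T ST; rewrite -!mulmxA; apply: (inspanM _ _ _) => //.
      exact: inspan_mem.
    by apply: inspanM => //; exact: inspan_mem.
have [r' [U [V [XUV r'E Uf Vf]]]] := full_rank_factor X.
pose M := V *m B *m U.
have XBXM : X *m B *m X = U *m M *m V by rewrite XUV /M !mulmxA.
have Mu : M \in unitmx.
  move: rXBX; rewrite XBXM mxrank_sandwich // => rM.
  by rewrite -row_free_unit -row_leq_rank (leq_trans _ rM) // r'E.
have trM k : \tr (mxpow M k) = 0.
  have -> : \tr (mxpow M k) = \tr (mxpow (X *m B) k).
    by rewrite XUV -mulmxA mxtrace_mxpowC.
  case: k => [|k]; first exact: trX.
  rewrite mxpowS -mulmxA; apply: (inspanM _ _ _) => //; first exact: inspan_mem.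
  exact: inspan_mxpow.
have r0 := mxtrace_pow_unit Mu trM.
by apply: X0; apply/eqP; rewrite -mxrank_eq0 -r'E r0.
Qed.
End Span.

(** * Partial isometries *)

Section Adjoint.
Variable C : numClosedFieldType.

Lemma adjmxM p q s (A : 'M[C]_(p, q)) (B : 'M[C]_(q, s)) :
  (A *m B) ^t* = B ^t* *m A ^t*.
Proof. by rewrite trmx_mul map_mxM. Qed.

Lemma adjmxB p q (A B : 'M[C]_(p, q)) : (A - B) ^t* = A ^t* - B ^t*.
Proof. by rewrite linearB map_mxB. Qed.

Lemma adjmx_mul_diag p q (A : 'M[C]_(p, q)) j :
  (A ^t* *m A) j j = \sum_i `|A i j| ^+ 2.
Proof. by rewrite mxE; apply: eq_bigr => i _; rewrite !mxE normCKC. Qed.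

(** The diagonal of A^* A consists of the squared lengths of the columns.
    Most identities about partial isometries below are obtained by applying this
    to a difference. *)
Lemma adjmx_mul_eq0 p q (A : 'M[C]_(p, q)) : A ^t* *m A = 0 -> A = 0.
Proof.
move=> A0; apply/matrixP => i j; have := adjmx_mul_diag A j.
rewrite A0 !mxE => /esym/eqP; rewrite psumr_eq0 => [/allP/(_ i)|k _].
  by rewrite mem_index_enum expf_eq0 /= normr_eq0 => /(_ isT)/eqP.
exact: exprn_ge0.
Qed.

Variable n : nat.
Implicit Types T P Q N : 'M[C]_n.

(** The equation T T^* T = T, which is shorter to work with than the two
    projection conditions and is equivalent to them ([partial_isometryP]). *)
Definition pisom T : Prop := T *m (T ^t* *m T) = T.

Lemma adj_mul_idem T : (T ^t* *m T) *m (T ^t* *m T) = T ^t* *m T -> pisom T.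
Proof.
move=> QQ; apply/eqP; rewrite eq_sym -subr_eq0; apply/eqP/adjmx_mul_eq0.
have Qh : (T ^t* *m T) ^t* = T ^t* *m T by rewrite adjmxM trmxCK.
rewrite adjmxB adjmxM Qh; set Q := T ^t* *m T in QQ Qh *.
rewrite mulmxBr !mulmxBl mulmxA -/Q.
have -> : Q *m T ^t* *m T = Q by rewrite -mulmxA -/Q QQ.
have -> : Q *m T ^t* *m (T *m Q) = Q.
  by rewrite mulmxA -[Q *m T^t* *m T]mulmxA -/Q !QQ.
by rewrite QQ !subrr.
Qed.

Lemma pisom_idem T : pisom T -> (T ^t* *m T) *m (T ^t* *m T) = T ^t* *m T.
Proof. by move=> TT; rewrite -mulmxA TT. Qed.

Lemma pisom_adj T : pisom T -> pisom (T ^t*).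
Proof. by move=> /(congr1 (fun A => A ^t*)); rewrite /pisom !adjmxM trmxCK mulmxA. Qed.

(** With Q = P^* P one computes (P - Q)^* (P - Q) = 0. *)
Lemma pisom_idempotent P : P *m P = P -> pisom P -> P ^t* = P.
Proof.
move=> PP piP; have QQ := pisom_idem piP.
have Qh : (P ^t* *m P) ^t* = P ^t* *m P by rewrite adjmxM trmxCK.
suff -> : P = P ^t* *m P by [].
apply/eqP; rewrite -subr_eq0; apply/eqP/adjmx_mul_eq0.
have PhPh : P ^t* *m P ^t* = P ^t* by rewrite -adjmxM PP.
rewrite adjmxB Qh mulmxBr !mulmxBl QQ.
rewrite -[P ^t* *m P *m P]mulmxA PP [P ^t* *m (P ^t* *m P)]mulmxA PhPh.
by rewrite !subrr.
Qed.

(** With X = P Q - P Q P the hypothesis gives X X^* = 0, and P Q = P Q P is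
    self-adjoint. *)
Lemma pisom_projections_commute P Q :
  P *m P = P -> P ^t* = P -> Q *m Q = Q -> Q ^t* = Q ->
  pisom (P *m Q) -> P *m Q = Q *m P.
Proof.
move=> PP Ph QQ Qh piPQ.
have FF : P *m Q *m P *m Q = P *m Q.
  by move: piPQ; rewrite /pisom adjmxM Ph Qh !mulmxA
    -[P *m Q *m Q]mulmxA QQ -[P *m Q *m P *m P]mulmxA PP.
have XE : P *m Q = P *m Q *m P.
  apply/eqP; rewrite -subr_eq0; apply/eqP.
  rewrite -[LHS]trmxCK; suff -> : (P *m Q - P *m Q *m P) ^t* = 0.
    by rewrite trmx0 map_mx0.
  apply: adjmx_mul_eq0; rewrite trmxCK adjmxB !adjmxM Ph Qh.
  rewrite mulmxBl !mulmxBr !mulmxA.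
  rewrite -[P *m Q *m Q]mulmxA QQ -[P *m Q *m P *m P]mulmxA PP FF.
  by rewrite !subrr.
have -> : Q *m P = (P *m Q *m P) ^t* by rewrite -XE adjmxM Ph Qh.
by rewrite !adjmxM Ph Qh mulmxA -XE.
Qed.

(** The initial projections of N and of N N have the same rank and one is
    below the other, so they coincide: N is isometric on its own range, which
    is then contained in the initial space. *)
Lemma pisom_square_range N : pisom N -> pisom (N *m N) ->
  \rank (N *m N) = \rank N -> N ^t* *m N *m N = N.
Proof.
move=> NQ NQ2 rkN; have QQ := pisom_idem NQ.
have Qh : (N ^t* *m N) ^t* = N ^t* *m N by rewrite adjmxM trmxCK.
have Qh2 : ((N *m N) ^t* *m (N *m N)) ^t* = (N *m N) ^t* *m (N *m N).
  by rewrite adjmxM trmxCK.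
rewrite /pisom in NQ NQ2; set Q := N ^t* *m N in QQ Qh NQ *.
have e : N ^t* *m Q *m N = (N *m N) ^t* *m (N *m N) by rewrite adjmxM !mulmxA.
set Q2 := (N *m N) ^t* *m _ in Qh2 NQ2 e.
have [D ND] : exists D, N = D *m (N *m N).
  apply/submxP; have [_ <-] := mxrank_leqif_sup (submxMl N N).
  by rewrite rkN.
have NQ2' : N *m Q2 = N by rewrite {1}ND -mulmxA NQ2 -ND.
have QQ2E : Q *m Q2 = Q by rewrite -mulmxA NQ2'.
have Q2QE : Q2 *m Q = Q2.
  by rewrite /Q2 -[_ *m (N *m N) *m Q]mulmxA -[N *m N *m Q]mulmxA NQ.
have QE : Q2 = Q by rewrite -Q2QE -{1}Qh2 -Qh -adjmxM QQ2E.
apply/eqP; rewrite -subr_eq0; apply/eqP/adjmx_mul_eq0.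
rewrite adjmxB adjmxM Qh mulmxBr !mulmxBl.
have -> : N ^t* *m Q *m (Q *m N) = Q by rewrite mulmxA -[N ^t* *m Q *m Q]mulmxA QQ e.
have -> : N ^t* *m (Q *m N) = Q by rewrite mulmxA e.
by rewrite e QE -/Q !subrr.
Qed.

Lemma mxpow_rank_stable T :
  exists k, \rank (mxpow T k *m mxpow T k) = \rank (mxpow T k).
Proof.
suff H r k : (\rank (mxpow T k) <= r)%N ->
    exists k, \rank (mxpow T k *m mxpow T k) = \rank (mxpow T k).
  exact: (H _ 0%N (leqnn _)).
elim: r k => [|r IH] k rk.
  exists k; apply/eqP; rewrite eqn_leq; apply/andP; split.
    exact/mxrankM_maxl.
  by move: rk; rewrite leqn0 => /eqP ->.
have [e|ne] := eqVneq (\rank (mxpow T k *m mxpow T k)) (\rank (mxpow T k)).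
  by exists k.
apply: (IH (k + k).+1); rewrite -ltnS (leq_trans _ rk) // -mxpowD.
by rewrite ltn_neqAle ne; exact: mxrankM_maxl.
Qed.

Lemma eigen_mxpow T (v : 'rV_n) z k :
  v *m T = z *: v -> v *m mxpow T k = z ^+ k.+1 *: v.
Proof.
move=> vT; elim: k => [|k IH]; first by rewrite expr1.
by rewrite mxpowS mulmxA vT -scalemxAl IH scalerA -exprS.
Qed.

(** A left eigenvector v for a nonzero eigenvalue lies in the row space of
    the power N, so v N N^* = v by [pisom_square_range] applied to N^*; comparing
    the lengths of v and v N gives the modulus. *)
Lemma power_pisom_eigenvalue T (v : 'rV_n) z :
  (forall k, pisom (mxpow T k)) ->
  v *m T = z *: v -> v <> 0 -> z <> 0 -> `|z| = 1.
Proof.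
move=> piT vT v0 z0; have [k rk] := mxpow_rank_stable T.
have piN := piT k; have piNN : pisom (mxpow T k *m mxpow T k).
  by rewrite mxpowD.
set N := mxpow T k in rk piN piNN.
have vN : v *m N = z ^+ k.+1 *: v by exact: eigen_mxpow.
set m := z ^+ k.+1 in vN.
have m0 : m != 0 by rewrite expf_neq0 //; apply/eqP.
have NNN : N *m (N *m N ^t*) = N.
  have := @pisom_square_range (N ^t*) (pisom_adj piN).
  rewrite -adjmxM !mxrank_map !mxrank_tr trmxCK.
  move=> /(_ (pisom_adj piNN) rk) /(congr1 (fun A => A ^t*)).
  by rewrite !adjmxM !trmxCK.
have vNN : v *m (N *m N ^t*) = v.
  apply: (scalerI m0); rewrite scalemxAl -vN -[LHS]mulmxA NNN.
  by rewrite vN.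
have vv : v *m v ^t* <> 0.
  move=> vv0; apply: v0; rewrite -[v]trmxCK.
  have -> : v ^t* = 0 by apply: adjmx_mul_eq0; rewrite trmxCK.
  by rewrite trmx0 map_mx0.
have m1 : (`|m| ^+ 2 - 1) *: (v *m v ^t*) = 0.
  have e : v *m v ^t* = (v *m N) *m (v *m N) ^t*.
    by rewrite adjmxM mulmxA -[v *m N *m N ^t*]mulmxA vNN.
  rewrite scalerBl scale1r [X in _ - X]e vN linearZ map_mxZ -scalemxAr -scalemxAl.
  by rewrite scalerA normCKC subrr.
move/eqP: m1; rewrite scaler_eq0 subr_eq0 => /orP[|/eqP//].
by rewrite normrX -exprM pexpr_eq1 // => /eqP.
Qed.

End Adjoint.

Lemma partial_isometryP (R : realType) (n : nat) (T : 'M[R[i]]_n) :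
  partial_isometry T <-> pisom T.
Proof.
split=> [[[QQ _] _]|piT]; first exact: adj_mul_idem.
split; split; rewrite ?adjmxM ?trmxCK //; first exact: pisom_idem.
by have := pisom_idem (pisom_adj piT); rewrite trmxCK.
Qed.
(** * Irreducible semigroups *)

Section Irreducible.

(** A subspace of largest dimension among those contained in P is all of P. *)
Lemma vspace_of_linear_pred (K : fieldType) (vT : vectType K) (P : vT -> Prop) :
  P 0 -> (forall a x y, P x -> P y -> P (a *: x + y)) ->
  exists V : {vspace vT}, forall x, x \in V <-> P x.
Proof.
move=> P0 Plin.
pose inP (V : {vspace vT}) := forall x, x \in V -> P x.
pose hasdim d := `[< exists2 V, inP V & \dim V = d >].
have ex0 : exists d, hasdim d.
  exists 0%N; apply/asboolP; exists 0%VS; rewrite ?dimv0 // => x.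
  by rewrite memv0 => /eqP ->.
have bnd d : hasdim d -> (d <= \dim {:vT})%N.
  by move=> /asboolP[V _ <-]; exact: dimvS (subvf V).
case: (ex_maxnP ex0 bnd) => d /asboolP[V VP Vd] dmax.
exists V => x; split; first exact: VP.
move=> Px; have VxP : inP (V + <[x]>)%VS.
  move=> y /memv_addP[u uV [w /vlineP[a ->] ->]].
  by rewrite addrC; apply: Plin => //; exact: VP.
have le : (\dim (V + <[x]>) <= \dim V)%N.
  by rewrite Vd; apply: dmax; apply/asboolP; exists (V + <[x]>)%VS.
have eqV : (V == V + <[x]>)%VS.
  by rewrite eqEdim addvSl.
by rewrite (eqP eqV) (subvP (addvSr V _)) // memv_line.
Qed.

Variables (R : realType) (n : nat).
Notation C := R[i].

(** Irreducibility in the form used everywhere below: some member sends a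
    given nonzero vector outside a given proper subspace. *)
Lemma irreducible_sep (SS : set 'M[C]_n) p q (X : 'M[C]_(p, n)) (Z : 'M[C]_(n, q)) :
  matrix_semigroup SS -> irreducible SS -> (exists2 T, SS T & T <> 0) ->
  X <> 0 -> Z <> 0 -> exists2 B, SS B & X *m B *m Z <> 0.
Proof.
move=> sgS irrS [T ST T0] X0 Z0; apply: contrapT => noB.
have XBZ B : SS B -> X *m B *m Z = 0.
  by move=> SB; apply: contrapT => ne; apply: noB; exists B.
have delta0 p' q' (A : 'M[C]_(p', q')) : (forall y : 'cV_q', A *m y = 0) -> A = 0.
  move=> A0; apply/matrixP => i j; have /matrixP/(_ i 0) := A0 (delta_mx j 0).
  by rewrite -colE !mxE.
(* W is the largest invariant subspace inside the kernel of X; it is trivial,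
   yet it contains the columns of every B Z. *)
have [W WP] := @vspace_of_linear_pred _ _
  (fun y : 'cV[C]_n => X *m y = 0 /\ forall B, SS B -> X *m (B *m y) = 0)
  ltac:(by split=> [|B _]; rewrite !mulmx0)
  ltac:(by move=> a x y [Xx XBx] [Xy XBy]; split=> [|B SB];
    rewrite ?mulmxDr -?scalemxAr ?mulmxDr -?scalemxAr ?Xx ?Xy ?XBx ?XBy // scaler0 addr0).
have BZ B : SS B -> B *m Z = 0.
  move=> SB; have [|W0|WT] := irrS W.
  - move=> A SA x /WP[Xx XBx]; apply/WP; split=> [|B' SB']; first exact: XBx.
    by rewrite [B' *m _]mulmxA; apply: XBx; exact: sgS.
  - apply: delta0 => y; rewrite -mulmxA.
    have : B *m (Z *m y) \in W.
      apply/WP; split=> [|B' SB']; first by rewrite !mulmxA XBZ // mul0mx.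
      by rewrite !mulmxA -[X *m B' *m B]mulmxA XBZ ?mul0mx //; exact: sgS.
    by rewrite W0 memv0 => /eqP.
  - case: X0; apply: delta0 => y.
    by have /WP[] : y \in W by rewrite WT memvf.
have [W' WP'] := @vspace_of_linear_pred _ _
  (fun y : 'cV[C]_n => forall B, SS B -> B *m y = 0)
  ltac:(by move=> B _; rewrite mulmx0)
  ltac:(by move=> a x y Bx By B SB; rewrite mulmxDr -scalemxAr Bx // By // scaler0 addr0).
have [|W0|WT] := irrS W'.
- move=> A SA x /WP' Bx; apply/WP' => B SB.
  by rewrite mulmxA; apply: Bx; exact: sgS.
- apply: Z0; apply: delta0 => y.
  have : Z *m y \in W' by apply/WP' => B SB; rewrite mulmxA BZ // mul0mx.
  by rewrite W0 memv0 => /eqP.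
- apply: T0; apply: delta0 => y.
  by have /WP'-> : y \in W' by rewrite WT memvf.
Qed.
End Irreducible.

(** * Boundedness from the spectrum *)

Section TraceEigenvalues.
Variable C : numClosedFieldType.

(** Compare the second highest coefficients of the characteristic polynomial
    and of its factorization. *)
Lemma mxtrace_eigenvalues n (T : 'M[C]_n) :
  exists s : seq C, [/\ size s = n, \tr T = \sum_(z <- s) z &
    forall z, z \in s -> eigenvalue T z].
Proof.
have [s sE] := closed_field_poly_normal (char_poly T).
move: sE; rewrite (monicP (char_poly_monic T)) scale1r => sE.
have ss : size s = n.
  by have := size_char_poly T; rewrite sE size_prod_XsubC => -[].
exists s; split => // [|z zs]; last first.
  by rewrite eigenvalue_root_char sE root_prod_XsubC.
case: n => [|n] in T sE ss *.
  by move/size0nil: ss => ->; rewrite big_nil /mxtrace big_ord0.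
have := @coefPn_prod_XsubC C s; rewrite ss => /(_ isT) trs.
by have := char_poly_trace T (isT : (0 < n.+1)%N); rewrite sE trs => /oppr_inj.
Qed.

Lemma mxtrace_le n (T : 'M[C]_n) :
  (forall z, eigenvalue T z -> `|z| <= 1) -> `|\tr T| <= n%:R.
Proof.
move=> T1; have [s [ss -> sT]] := mxtrace_eigenvalues T.
rewrite -ss -sum1_size natr_sum (le_trans (ler_norm_sum _ _ _)) //.
rewrite big_seq [leRHS]big_seq; apply: ler_sum => z /sT; exact: T1.
Qed.

Lemma mxtrace_neq0_eigenvalue n (T : 'M[C]_n) :
  \tr T <> 0 -> exists2 z, eigenvalue T z & z <> 0.
Proof.
move=> T0; have [s [_ sE sT]] := mxtrace_eigenvalues T.
apply: contrapT => no; apply: T0; rewrite sE big_seq; apply: big1 => z /sT Tz.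
by apply: contrapT => z0; apply: no; exists z.
Qed.
End TraceEigenvalues.

Section Boundedness.
Variables (R : realType) (n : nat).
Notation C := R[i].
Variables (U : set_system nat) (UF : UltraFilter U).
Hypothesis Uoo : \oo `<=` U.
Implicit Types (SS : set 'M[C]_n) (T X L : 'M[C]_n).

Lemma slim_mxnorm1 p q (A : nat -> 'M[C]_(p, q)) (L : 'M_(p, q)) :
  mlim U A L -> slim U (fun k => mxnorm1 (A k)) (mxnorm1 L).
Proof.
move=> [AL]; apply: slim_sum => i; apply: slim_sum => j.
by apply: slim_norm.
Qed.

Lemma mlimB p q (A B : nat -> 'M[C]_(p, q)) (L M : 'M_(p, q)) :
  mlim U A L -> mlim U B M -> mlim U (fun k => A k - B k) (L - M).
Proof.
move=> [AL] [BM]; constructor=> i j; rewrite !mxE.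
apply: (@slim_ext _ _ (fun k => A k i j - B k i j)); first by move=> k; rewrite !mxE.
by apply: slimD => //; exact: slimN.
Qed.

Lemma norm_closed_mlim SS (A : nat -> 'M[C]_n) L :
  norm_closed SS -> (forall k, SS (A k)) -> mlim U A L -> SS L.
Proof.
move=> clS SA AL; apply: clS => e e0.
have := slim_mxnorm1 (mlimB AL (mlim_cst UF L)); rewrite subrr mxnorm1_0 => lim0.
have e0C : 0 < e%:C by rewrite -[0]/(0%:C) ltcR.
have [k] := slim_eps UF lim0 e0C; rewrite subr0 ger0_norm ?mxnorm1_ge0 // => kE.
exists (A k) => //; rewrite -ltcR; apply: le_lt_trans kE; exact: opnorm_le_mxnorm1.
Qed.

(** One constant for both bounds of condition (iii), in terms of the
    entrywise norm; the bounds of (iii) and this one imply each other. *)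
Definition bibounded SS (c : C) : Prop :=
  forall T, SS T -> mxnorm1 T <= c /\ (T <> 0 -> 1 <= c * mxnorm1 T).

Lemma opnorm_bounds_bibounded SS (c1 c2 : R) : 0 < c1 -> 0 < c2 ->
  (forall T, SS T -> T <> 0 -> c1 <= opnorm T <= c2) -> exists c, bibounded SS c.
Proof.
move=> c10 c20 Sc; have c10C : 0 < c1%:C by rewrite -[0]/(0%:C) ltcR.
have c20C : 0 < c2%:C by rewrite -[0]/(0%:C) ltcR.
have b0 : 0 <= (n * n)%:R * c2%:C by rewrite mulr_ge0 ?ler0n // ltW.
exists ((n * n)%:R * c2%:C + c1%:C^-1) => T ST.
have [->|/eqP T0] := eqVneq T 0.
  by split=> //; rewrite mxnorm1_0 addr_ge0 // invr_ge0 ltW.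
have /andP[cT1 cT2] := Sc T ST T0; split=> [|_].
  rewrite (@le_trans _ _ ((n * n)%:R * c2%:C)) ?lerDl ?invr_ge0 ?(ltW c10C) //.
  apply: mxnorm1_le => i j; apply: le_trans (entry_le_opnorm T i j) _.
  by rewrite lecR.
rewrite mulrDl (@le_trans _ _ (c1%:C^-1 * mxnorm1 T)) //; last first.
  by rewrite lerDr; apply: mulr_ge0; last exact: mxnorm1_ge0.
rewrite mulrC ler_pdivlMr // mul1r.
by apply: le_trans (opnorm_le_mxnorm1 T); rewrite lecR.
Qed.

Lemma bibounded_opnorm_bounds SS c : bibounded SS c ->
  exists c1 c2 : R, [/\ 0 < c1, 0 < c2 &
      forall T, SS T -> T <> 0 -> c1 <= opnorm T <= c2].
Proof.
move=> Sc; have [[T ST T0]|no] := pselect (exists2 T, SS T & T <> 0); last first.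
  by exists 1, 1; split=> // T ST T0; case: no; exists T.
have [cT _] := Sc T ST; have c0 : 0 < c by exact: lt_le_trans (mxnorm1_gt0 T0) cT.
have cE : (Re c)%:C = c by rewrite RRe_real // gtr0_real.
have d0 : 0 < Re c by rewrite -ltcR cE.
have n0 : 0 < (n * n)%:R :> R.
  rewrite ltr0n; apply: contraPT T0; rewrite muln_gt0 andbb => /negP n0; apply.
  apply/matrixP => i; case: n0; exact: leq_ltn_trans (leq0n i) (ltn_ord i).
exists ((Re c * (n * n)%:R)^-1), (Re c); split=> // [|T' ST' T'0].
  by rewrite invr_gt0 mulr_gt0.
have [cT' /(_ T'0) cT'0] := Sc T' ST'; apply/andP; split.
  rewrite -[leLHS]mul1r ler_pdivrMr ?mulr_gt0 // -lecR.
  rewrite !rmorphM /= cE rmorph_nat; apply: le_trans cT'0 _.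
  rewrite [leRHS]mulrCA ler_wpM2l ?(ltW c0) // [leRHS]mulrC.
  by rewrite -natrM; apply: mxnorm1_le => i j; exact: entry_le_opnorm.
by rewrite -lecR cE (le_trans (opnorm_le_mxnorm1 T')).
Qed.

Lemma mxnorm1_eigenvalue T z : eigenvalue T z -> `|z| <= mxnorm1 T.
Proof.
move=> /eigenvalueP[v vT /eqP v0].
have v0' := mxnorm1_gt0 v0.
by rewrite -(ler_pM2l v0') mulrC -mxnorm1Z -vT mxnorm1M.
Qed.

Section SpectralRadius.
Variable SS : set 'M[C]_n.
Hypothesis sgS : matrix_semigroup SS.
Hypothesis sep : forall X Z : 'M[C]_n, X <> 0 -> Z <> 0 ->
  exists2 B, SS B & X *m B *m Z <> 0.
Hypothesis spS : forall T z, SS T -> eigenvalue T z -> z <> 0 -> `|z| = 1.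

(** If the semigroup were unbounded, its members rescaled to norm one would
    have a limit L of norm one in the span; since traces of members stay bounded,
    L would be in the radical of the trace form. *)
Lemma spectral_bound : exists c, forall T, SS T -> mxnorm1 T <= c.
Proof.
apply: contrapT => unb.
(* Norms above k+1 make the rescaled traces at most n/(k+1). *)
have /choice[T TP] : forall k : nat, exists T, SS T /\ k.+1%:R < mxnorm1 T.
  move=> k; apply: contrapT => no; apply: unb; exists k.+1%:R => T ST.
  rewrite real_leNgt ?realn ?ger0_real ?mxnorm1_ge0 //; apply/negP => lt.
  by apply: no; exists T.
have N0 k : 0 < mxnorm1 (T k) by have [_] := TP k; apply: le_lt_trans; rewrite ler0n.
pose X k := (mxnorm1 (T k))^-1 *: T k.
have XN k : mxnorm1 (X k) = 1.
  by rewrite mxnorm1Z ger0_norm ?invr_ge0 ?mxnorm1_ge0 // mulVf // gt_eqF.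
have [L XL] : exists L, mlim U X L.
  by apply: (@mlim_exists U UF _ _ _ _ 1) => k i j; rewrite -(XN k) entry_le_mxnorm1.
have LN : mxnorm1 L = 1.
  apply: (slim_uniq UF (slim_mxnorm1 XL)).
  by apply: (slim_ext _ (slim_cst UF 1)) => k; rewrite XN.
suff L0 : L = 0 by move: LN; rewrite L0 mxnorm1_0 => /esym/eqP; rewrite oner_eq0.
apply: (@trace_form_nondegenerate _ _ SS) => // [D D0|S0 SS0].
  apply: (slim_uniq UF (slim_trace UF (mlimM UF (mlim_cst UF D) XL))).
  apply: (slim_ext _ (slim_cst UF 0)) => k; rewrite -scalemxAr linearZ /= D0 ?mulr0 //.
  by case: (TP k).
have h0 : slim U (fun k => n%:R * k.+1%:R^-1) (0 : C).
  rewrite -[0](mulr0 n%:R).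
  apply: (@slimM U UF _ (fun=> n%:R) (fun k => k.+1%:R^-1)); first exact: slim_cst.
  have hr : slim U (@harmonic R) 0.
    by apply: slim_of_cvg => //; exact: cvg_harmonic.
  apply: slim_ext (slim_embed UF hr) => k /=.
  by rewrite fmorphV rmorph_nat.
apply/eqP; rewrite -normr_le0.
have trL := slim_norm UF (slim_trace UF (mlimM UF XL (mlim_cst UF S0))).
apply: (slim_le UF trL h0) => k.
have [Sk Tk] := TP k.
rewrite -scalemxAl linearZ /= normrM mulrC ler_pM //.
  apply: mxtrace_le => z Tz; have [->|/eqP z0] := eqVneq z 0; first by rewrite normr0.
  by rewrite (spS _ Tz) //; exact: sgS.
by rewrite normfV ger0_norm ?mxnorm1_ge0 // lef_pV2 ?posrE // ltW.
Qed.

(** For the lower bound, nondegeneracy gives B such that T B has nonzero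
    trace, hence an eigenvalue of modulus one and norm at least one. *)
Lemma spectral_bibounded : exists c, bibounded SS c.
Proof.
have [c Sc] := spectral_bound; exists c => T ST; split=> [|T0]; first exact: Sc.
have [[B SB trB]|no] := pselect (exists2 B, SS B & \tr (T *m B) <> 0); last first.
  case: T0; apply: (@trace_form_nondegenerate _ _ SS) => //; first exact: inspan_mem.
  by move=> B SB; apply: contrapT => trB; apply: no; exists B.
have [z Tz z0] := mxtrace_neq0_eigenvalue trB.
rewrite -(spS (sgS ST SB) Tz z0) (le_trans (mxnorm1_eigenvalue Tz)) //.
rewrite (le_trans (mxnorm1M _ _)) // mulrC ler_wpM2r ?mxnorm1_ge0 //; exact: Sc.
Qed.
End SpectralRadius.
End Boundedness.

(** * Bounded groups of matrices are unitarizable *)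

Section SquaredNorm.
Variable C : numClosedFieldType.

Definition sqn m (x : 'cV[C]_m) : C := (x ^t* *m x) 0 0.

Lemma sqnE m (x : 'cV[C]_m) : sqn x = \sum_i `|x i 0| ^+ 2.
Proof. exact: adjmx_mul_diag. Qed.

Lemma sqn_ge0 m (x : 'cV[C]_m) : 0 <= sqn x.
Proof. by rewrite sqnE sumr_ge0 // => i _; exact: exprn_ge0. Qed.

Lemma sqnZ m a (x : 'cV[C]_m) : sqn (a *: x) = `|a| ^+ 2 * sqn x.
Proof.
by rewrite !sqnE mulr_sumr; apply: eq_bigr => i _; rewrite mxE normrM exprMn.
Qed.

Lemma coord_le_sqn m (x : 'cV[C]_m) i : `|x i 0| ^+ 2 <= sqn x.
Proof. by rewrite sqnE (bigD1 i) //= lerDl sumr_ge0 // => j _; exact: exprn_ge0. Qed.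

Lemma sqn_mul_le m (A : 'M[C]_m) (x : 'cV[C]_m) :
  sqn (A *m x) <= (mxnorm1 A * m%:R) ^+ 2 * sqn x.
Proof.
have sx : 0 <= sqrtC (sqn x) by rewrite sqrtC_ge0 sqn_ge0.
have xN : mxnorm1 x <= m%:R * sqrtC (sqn x).
  have -> : m%:R = (m * 1)%:R :> C by rewrite muln1.
  apply: mxnorm1_le => i j; rewrite ord1.
  by rewrite -(@ler_pXn2r _ 2) ?nnegrE // sqrtCK coord_le_sqn.
have -> : sqn x = sqrtC (sqn x) ^+ 2 by rewrite sqrtCK.
rewrite -exprMn (@le_trans _ _ (mxnorm1 (A *m x) ^+ 2)) //.
  rewrite sqnE /mxnorm1; under [X in _ <= X ^+ 2]eq_bigr do rewrite big_ord1.
  exact: sum_sqr_le.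
rewrite ler_pXn2r ?nnegrE ?mxnorm1_ge0 ?mulr_ge0 ?ler0n ?mxnorm1_ge0 //.
apply: le_trans (mxnorm1M _ _) _; rewrite -mulrA ler_wpM2l ?mxnorm1_ge0 //.
Qed.

End SquaredNorm.

Section Midpoint.
Variable C : numClosedFieldType.

(** Each factor is at most the whole product. *)
Lemma prod_ge1_eq1 (I : finType) (f : I -> C) :
  (forall i, 1 <= f i) -> \prod_i f i <= 1 -> forall i, f i = 1.
Proof.
move=> f1 pf i; apply/le_anti; rewrite f1 andbT; apply: le_trans pf.
rewrite (bigD1 i) //= ler_peMr ?(le_trans ler01) //.
by elim/big_ind: _ => // x y x1 y1; rewrite mulr_ege1.
Qed.

(** The squares of the means (1 + d i)/2 dominate the d i, and the product of
    the quotients is at most 1, so each quotient equals 1. *)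
Lemma amgm_eq1 (I : finType) (d : I -> C) :
  (forall i, 0 <= d i) -> \prod_i d i = 1 -> \prod_i ((1 + d i) / 2) <= 1 ->
  forall i, d i = 1.
Proof.
move=> d0 pd pe i.
have dp j : 0 < d j.
  rewrite lt0r d0 andbT; apply/eqP => dj0.
  by have /eqP := pd; rewrite (bigD1 j) //= dj0 mul0r eq_sym oner_eq0.
pose f j := ((1 + d j) / 2) ^+ 2 / d j.
have f1 j : 1 <= f j.
  rewrite /f ler_pdivlMr // mul1r -subr_ge0.
  have -> : ((1 + d j) / 2) ^+ 2 - d j = ((1 - d j) / 2) ^+ 2.
    by field.
  by rewrite real_exprn_even_ge0 // realM ?realV ?realn // rpredB ?rpred1 // ger0_real.
have pf : \prod_j f j <= 1.
  rewrite /f prodf_div pd divr1 prodrXl exprn_ile1 //.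
  by apply: prodr_ge0 => j _; rewrite divr_ge0 ?addr_ge0 ?ler0n ?ler01.
have := prod_ge1_eq1 f1 pf i; rewrite /f => /(canRL (mulfVK _)).
rewrite gt_eqF // => /(_ isT) e.
have /eqP : ((1 - d i) / 2) ^+ 2 = 0.
  have -> : ((1 - d i) / 2) ^+ 2 = ((1 + d i) / 2) ^+ 2 - d i by field.
  by rewrite e mul1r subrr.
rewrite expf_eq0 /= mulf_eq0 invr_eq0 pnatr_eq0 orbF subr_eq0.
by move=> /eqP <-.
Qed.

(** The determinant is strictly log-concave on positive definite matrices;
    here at the midpoint of the identity and X^* X.  In an orthonormal
    eigenbasis of X^* X this is the arithmetic-geometric inequality. *)
Lemma midpoint_factor r (X : 'M[C]_r) : `|\det X| = 1 ->
  exists2 Y : 'M[C]_r, Y ^t* *m Y = 2^-1 *: (1%:M + X ^t* *m X) &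
    `|\det Y| <= 1 -> X ^t* *m X = 1%:M.
Proof.
move=> detX; set H := X ^t* *m X.
have Hh : H ^t* = H by rewrite adjmxM trmxCK.
have /orthomx_spectralP : H \is normalmx by apply/normalmxP; rewrite Hh.
set P := spectralmx H; set d := spectral_diag H => HE.
have Pu : P \is unitarymx by exact: spectral_unitarymx.
have Punit := unitarymx_unit Pu.
have PV : invmx P = P ^t* by exact: invmx_unitary.
have dE : diag_mx d = (X *m P ^t*) ^t* *m (X *m P ^t*).
  rewrite adjmxM trmxCK !mulmxA -[P *m X ^t* *m X]mulmxA -/H HE PV.
  rewrite !mulmxA -PV mulmxV // mul1mx -mulmxA mulmxV // mulmx1 //.
have d0 i : 0 <= d 0 i.
  have -> : d 0 i = diag_mx d i i by rewrite mxE eqxx.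
  by rewrite dE adjmx_mul_diag sumr_ge0 // => j _; exact: exprn_ge0.
pose e : 'rV[C]_r := \row_i ((1 + d 0 i) / 2).
have e0 i : 0 <= e 0 i by rewrite mxE divr_ge0 ?addr_ge0 ?ler0n ?ler01.
pose s : 'rV[C]_r := \row_i sqrtC (e 0 i).
pose Y := diag_mx s *m P.
have YY : Y ^t* *m Y = P ^t* *m diag_mx e *m P.
  rewrite adjmxM mulmxA -[P ^t* *m _ *m diag_mx s]mulmxA; congr (_ *m _ *m _).
  rewrite tr_diag_mx map_diag_mx mulmx_diag; congr diag_mx.
  apply/rowP => i; rewrite !mxE /= conj_Creal ?ger0_real ?sqrtC_ge0 //.
    by rewrite -expr2 sqrtCK.
  by have := e0 i; rewrite mxE.
have detadj (M : 'M[C]_r) : \det (M ^t* *m M) = `|\det M| ^+ 2.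
  by rewrite det_mulmx det_map_mx det_tr normCKC.
exists Y => [|detY].
  rewrite YY HE -PV; have -> : diag_mx e = 2^-1 *: (1%:M + diag_mx d).
    apply/matrixP => i j; rewrite !mxE; case: eqVneq => _; rewrite ?mulr1n ?mulr0n.
      by rewrite mulrC.
    by rewrite addr0 mulr0.
  by rewrite -scalemxAr -scalemxAl mulmxDr mulmxDl mulmx1 mulVmx.
have pd : \prod_i d 0 i = 1.
  have := detadj X; rewrite detX expr1n -/H HE !det_mulmx det_inv det_diag.
  by rewrite mulrAC mulVr ?mul1r // -unitmxE.
have pe : \prod_i ((1 + d 0 i) / 2) <= 1.
  have := detadj Y; rewrite YY -PV det_mulmx (det_mulmx (invmx P)) det_inv det_diag.
  rewrite mulrAC mulVr ?mul1r -?unitmxE // => eE.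
  rewrite (eq_bigr (fun i => e 0 i)) => [|i _]; last by rewrite mxE.
  by rewrite eE exprn_ile1.
have d1 := amgm_eq1 d0 pd pe.
have -> : H = invmx P *m diag_mx d *m P by [].
have -> : diag_mx d = 1%:M.
  by apply/matrixP => i j; rewrite !mxE d1.
by rewrite mulmx1 mulVmx.
Qed.

Lemma midpoint_gram r (X Y : 'M[C]_r) (w : 'cV[C]_r) :
  Y ^t* *m Y = 2^-1 *: (1%:M + X ^t* *m X) ->
  (Y *m w) ^t* *m (Y *m w) =
  2^-1 *: (w ^t* *m w + (X *m w) ^t* *m (X *m w)).
Proof.
move=> YY; rewrite !adjmxM mulmxA -[w ^t* *m _ *m Y]mulmxA YY.
by rewrite -scalemxAr -scalemxAl mulmxDr mulmxDl mulmx1 !mulmxA.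
Qed.

Lemma sqn_midpoint_le r (X Y : 'M[C]_r) (w : 'cV[C]_r) s :
  Y ^t* *m Y = 2^-1 *: (1%:M + X ^t* *m X) ->
  sqn w <= s -> sqn (X *m w) <= s -> sqn (Y *m w) <= s.
Proof.
move=> YY ws Xws; have -> : sqn (Y *m w) = 2^-1 * (sqn w + sqn (X *m w)).
  by rewrite /sqn (midpoint_gram w YY) mxE [in LHS]mxE.
by rewrite mulrC ler_pdivrMr ?ltr0n // mulr_natr mulr2n lerD.
Qed.

Lemma gram_unitary r (X Z A : 'M[C]_r) : Z *m A = X *m Z -> X ^t* *m X = 1%:M ->
  (Z *m A) ^t* *m (Z *m A) = Z ^t* *m Z.
Proof.
by move=> -> XX; rewrite adjmxM mulmxA -[Z ^t* *m _ *m X]mulmxA XX mulmx1.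
Qed.
End Midpoint.

Section Unitarize.
Variables (R : realType) (r : nat).
Notation C := R[i].
Variables (U : set_system nat) (UF : UltraFilter U).
Hypothesis Uoo : \oo `<=` U.

Lemma slim_sqn m (x : nat -> 'cV[C]_m) y :
  mlim U x y -> slim U (fun k => sqn (x k)) (sqn y).
Proof.
move=> [xy]; rewrite sqnE.
apply: (@slim_ext _ _ (fun k => \sum_i `|x k i 0| * `|x k i 0|)).
  by move=> k; rewrite sqnE; apply: eq_bigr => i _; rewrite expr2.
apply: slim_sum => i; rewrite expr2.
by apply: slimM => //; exact: slim_norm.
Qed.

Lemma det_bound (c : C) :
  exists b, forall A : 'M[C]_r, (forall i j, `|A i j| <= c) -> `|\det A| <= b.
Proof.
exists (\sum_(s : {perm 'I_r}) \prod_(i < r) c) => A Ac.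
apply: le_trans (ler_norm_sum _ _ _) _; apply: ler_sum => s _.
rewrite normrM normrX normrN1 expr1n mul1r normr_prod.
by apply: ler_prod => i _; rewrite normr_ge0 Ac.
Qed.

Variable G : set 'M[C]_r.
Hypothesis GM : forall A B, G A -> G B -> G (A *m B).
Hypothesis G1 : G 1%:M.
Variable c : C.
Hypothesis Gc : forall A, G A -> mxnorm1 A <= c.
Hypothesis Gdet : forall A, G A -> `|\det A| = 1.

Let K (Z : 'M[C]_r) := forall A, G A -> forall x : 'cV[C]_r, sqn (Z *m (A *m x)) <= sqn x.

(** The matrices satisfying K are bounded because G contains the identity, they
    form a closed set, and a small scalar matrix is among them because G is
    bounded. *)
Lemma contractions_max : exists2 Z, K Z /\ Z \in unitmx &
  forall Z', K Z' -> `|\det Z'| <= `|\det Z|.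
Proof.
have c0 : 0 <= c by exact: le_trans (mxnorm1_ge0 _) (Gc G1).
have K1 Z : K Z -> forall i j, `|Z i j| <= 1.
  move=> KZ i j; rewrite -(@ler_pXn2r _ 2) ?nnegrE // expr1n.
  have -> : Z i j = (Z *m (1%:M *m (delta_mx j 0 : 'cV_r))) i 0.
    by rewrite mul1mx -colE mxE.
  apply: le_trans (coord_le_sqn _ _) _; apply: le_trans (KZ _ G1 _) _.
  rewrite sqnE (bigD1 j) //= mxE !eqxx normr1 expr1n big1 ?addr0 // => k kj.
  by rewrite mxE (negbTE kj) normr0 expr0n.
have [b bP] := det_bound 1.
pose dr (Z : 'M[C]_r) : R := Re `|\det Z|.
have drE Z : (dr Z)%:C = `|\det Z| by rewrite RRe_real // ger0_real.
pose E := [set dr Z | Z in K].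
pose a : C := (c * r%:R + 1)^-1.
have cr0 : 0 < c * r%:R + 1 by rewrite ltr_wpDl // mulr_ge0 ?ler0n.
have Ka : K a%:M.
  move=> A GA x; rewrite mul_scalar_mx sqnZ.
  apply: le_trans (ler_wpM2l _ (sqn_mul_le A x)) _; first exact: exprn_ge0.
  rewrite mulrA -exprMn ler_piMl ?sqn_ge0 // exprn_ile1 //.
    by rewrite mulr_ge0 // mulr_ge0 ?mxnorm1_ge0 ?ler0n.
  rewrite ger0_norm ?invr_ge0 ?(ltW cr0) // mulrC ler_pdivrMr // mul1r.
  by rewrite (@le_trans _ _ (c * r%:R)) ?lerDl // ler_wpM2r ?ler0n ?Gc.
have b0 : 0 <= b by apply: le_trans (normr_ge0 _) (bP _ (K1 _ Ka)).
have bE : (Re b)%:C = b by rewrite RRe_real // ger0_real.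
have supE : has_sup E.
  split; first by exists (dr a%:M), a%:M.
  by exists (Re b) => _ [Z KZ <-]; rewrite -lecR drE bE; apply: bP; exact: K1.
have /choice[Z ZP] : forall k : nat, exists Z, K Z /\ sup E - k.+1%:R^-1 <= dr Z.
  move=> k; have k0 : 0 < k.+1%:R^-1 :> R by rewrite invr_gt0 ltr0n.
  by have [_ [Z KZ <-] lt] := sup_adherent k0 supE; exists Z; split=> //; exact: ltW.
have [L ZL] : exists L, mlim U Z L.
  apply: (@mlim_exists U UF _ _ _ _ 1) => k; apply: K1; by case: (ZP k).
have KL : K L.
  move=> A GA x.
  apply: (slim_le UF (slim_sqn (mlimM UF ZL (mlim_cst UF (A *m x)))) (slim_cst UF _)) => k.
  by have [KZ _] := ZP k; exact: KZ.
have hr : slim U (@harmonic R) 0.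
  by apply: slim_of_cvg => //; exact: cvg_harmonic.
have le : (sup E)%:C <= `|\det L|.
  have l1 := slimD UF (slim_cst UF (sup E)) (slimN UF hr); rewrite subr0 in l1.
  apply: (slim_le UF (slim_embed UF l1) (slim_norm UF (slim_det UF ZL))) => k.
  by have [_ kE] := ZP k; rewrite -drE lecR.
have maxL Z' : K Z' -> `|\det Z'| <= `|\det L|.
  move=> KZ'; apply: le_trans le; rewrite -drE lecR; apply: sup_upper_bound => //.
  by exists Z'.
exists L => //; split=> //; rewrite unitmxE unitfE -normr_gt0.
apply: lt_le_trans (maxL _ Ka); rewrite normr_gt0 det_scalar expf_neq0 //.
by rewrite invr_eq0 gt_eqF.
Qed.

(** For a maximal Z and A in G, the matrix Z A satisfies K with the same
    |det|.  A square root of the mean of the two Gram matrices also satisfies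
    K, and strict concavity forces the Gram matrices to be equal. *)
Lemma unitarizable : exists2 Z : 'M[C]_r, Z \in unitmx &
  forall A, G A -> (Z *m A) ^t* *m (Z *m A) = Z ^t* *m Z.
Proof.
have [Z [KZ Zu] maxZ] := contractions_max.
exists Z => // A GA; pose X := Z *m A *m invmx Z.
have ZA : Z *m A = X *m Z by rewrite mulmxKV.
have detZ : \det Z != 0 by rewrite -unitfE -unitmxE.
have detX : `|\det X| = 1.
  by rewrite !det_mulmx det_inv mulrAC mulfV // mul1r Gdet.
have [Y YY Y1] := midpoint_factor detX.
have KYZ : K (Y *m Z).
  move=> B GB x; rewrite -mulmxA; set w := Z *m (B *m x).
  apply: (sqn_midpoint_le YY); first exact: KZ.
  have -> : X *m w = Z *m ((A *m B) *m x).
    by rewrite /w mulmxA -ZA !mulmxA.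
  by apply: KZ; exact: GM.
have /Y1 XX : `|\det Y| <= 1.
  have := maxZ _ KYZ; rewrite det_mulmx normrM.
  by rewrite -[leRHS]mul1r ler_pM2r // normr_gt0.
exact: gram_unitary ZA XX.
Qed.
End Unitarize.

(** * Members of minimal rank: algebra *)

Section GramFactor.
Variable C : numClosedFieldType.

Lemma gram_factor n (H : 'M[C]_n) : H ^t* = H ->
  (forall x : 'cV[C]_n, 0 <= (x ^t* *m H *m x) 0 0) ->
  exists Z : 'M[C]_n, Z ^t* *m Z = H.
Proof.
move=> Hh H0; have /orthomx_spectralP : H \is normalmx by apply/normalmxP; rewrite Hh.
set P := spectralmx H; set d := spectral_diag H => HE.
have Pu : P \is unitarymx by exact: spectral_unitarymx.
have Punit := unitarymx_unit Pu.
have PV : invmx P = P ^t* by exact: invmx_unitary.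
have d0 i : 0 <= d 0 i.
  have := H0 (P ^t* *m delta_mx i 0); rewrite adjmxM trmxCK HE PV !mulmxA.
  rewrite -[_ *m P *m P ^t*]mulmxA -PV mulmxV // mulmx1.
  rewrite -[_ *m P *m invmx P]mulmxA mulmxV // mulmx1.
  by rewrite trmx_delta map_delta_mx -rowE -colE !mxE eqxx.
exists (diag_mx (\row_i sqrtC (d 0 i)) *m P).
rewrite adjmxM mulmxA -[P ^t* *m _ *m diag_mx _]mulmxA HE PV; congr (_ *m _ *m _).
rewrite tr_diag_mx map_diag_mx mulmx_diag; congr diag_mx.
apply/rowP => i; rewrite !mxE /= conj_Creal ?ger0_real ?sqrtC_ge0 //.
by rewrite -expr2 sqrtCK.
Qed.
End GramFactor.

Section Brandt.
Variables (C : numClosedFieldType) (n : nat) (SS : set 'M[C]_n).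
Implicit Types A B E F T Y : 'M[C]_n.
Hypothesis sgS : mxsemigroup SS.
Hypothesis sep : forall X Z : 'M[C]_n, X <> 0 -> Z <> 0 ->
  exists2 B, SS B & X *m B *m Z <> 0.
Hypothesis idemC : forall P Q, SS P -> SS Q -> P *m P = P -> Q *m Q = Q ->
  P *m Q = Q *m P.
Variable r : nat.
Hypothesis rmin : forall A, SS A -> A <> 0 -> (r <= \rank A)%N.
Hypothesis reg : forall A, SS A -> A <> 0 -> (\rank A <= r)%N ->
  exists2 Y, SS Y & A *m Y *m A = A.

(** A nonzero member has rank at least r, so these have rank exactly r. *)
Definition minidem E : Prop :=
  [/\ SS E, E *m E = E, E <> 0 & (\rank E <= r)%N].

(** The idempotents E F = F E and E have the same rank, and the row space of
    the first is contained in that of the second. *)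
Lemma minidem_absorb E F : minidem E -> minidem F -> E *m F <> 0 -> E *m F = E.
Proof.
move=> [SE EE E0 rE] [SF FF F0 rF] EF0.
have C1 : E *m F = F *m E by exact: idemC.
have [D ED] : exists D, E = D *m (F *m E).
  apply/submxP; have [_ <-] := mxrank_leqif_sup (submxMl F E).
  rewrite eqn_leq mxrankM_maxr (leq_trans rE) // rmin //; first exact: sgS.
  by rewrite -C1.
by rewrite {1}ED -!mulmxA C1 [F *m (F *m E)]mulmxA FF -ED.
Qed.

Lemma minidem_eq E F : minidem E -> minidem F -> E *m F <> 0 -> E = F.
Proof.
move=> mE mF EF0; rewrite -(minidem_absorb mE mF EF0).
have [SE EE _ _] := mE; have [SF FF _ _] := mF.
by rewrite idemC // minidem_absorb // -idemC.
Qed.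

Lemma minidem_orth E F : minidem E -> minidem F -> E <> F -> E *m F = 0.
Proof. by move=> mE mF EF; apply: contrapT => /(minidem_eq mE mF). Qed.

Lemma minidem_left A : SS A -> A <> 0 -> (\rank A <= r)%N ->
  exists2 Y, SS Y & minidem (A *m Y) /\ A *m Y *m A = A.
Proof.
move=> SA A0 rA; have [Y SY AYA] := reg SA A0 rA; exists Y => //; split=> //; split.
- exact: sgS.
- by rewrite mulmxA AYA.
- by move=> AY0; apply: A0; rewrite -AYA AY0 mul0mx.
- exact: leq_trans (mxrankM_maxl _ _) rA.
Qed.

Lemma minidem_right A : SS A -> A <> 0 -> (\rank A <= r)%N ->
  exists2 Y, SS Y & minidem (Y *m A) /\ A *m (Y *m A) = A.
Proof.
move=> SA A0 rA; have [Y SY AYA] := reg SA A0 rA; exists Y => //.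
rewrite mulmxA; split=> //; split.
- exact: sgS.
- by rewrite -mulmxA [A *m (Y *m A)]mulmxA AYA.
- by move=> YA0; apply: A0; rewrite -AYA -mulmxA YA0 mulmx0.
- exact: leq_trans (mxrankM_maxr _ _) rA.
Qed.

Lemma sum_orth m (s : seq 'M[C]_n) (f : 'M[C]_n -> 'M[C]_(m, n)) E :
  uniq s -> E \in s -> (forall F, F \in s -> F <> E -> f F *m E = 0) ->
  (\sum_(F <- s) f F) *m E = f E *m E.
Proof.
move=> us Es f0; rewrite mulmx_suml (bigD1_seq E) //= big_seq_cond big1 ?addr0 //.
by move=> F /andP[Fs /eqP FE]; exact: f0.
Qed.

Lemma rank_sum_minidem s : uniq s -> (forall E, E \in s -> minidem E) ->
  (size s <= \rank (\sum_(E <- s) E)%R)%N.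
Proof.
elim: s => [|E s IH] //= /andP[Es us] mS; rewrite big_cons.
have mE : minidem E by apply: mS; exact: mem_head.
have mS' F : F \in s -> minidem F by move=> Fs; apply: mS; rewrite in_cons Fs orbT.
set P := \sum_(F <- s) F in IH *.
have ne F : F \in s -> E <> F by move=> Fs EF; rewrite EF Fs in Es.
have EP : E *m P = 0.
  rewrite mulmx_sumr big_seq big1 // => F Fs.
  by apply: minidem_orth => //; [exact: mS'|exact: ne].
have PE : P *m E = 0.
  rewrite mulmx_suml big_seq big1 // => F Fs.
  by apply: minidem_orth => //; [exact: mS'|move=> FE; exact: (ne F)].
have PP : P *m P = P.
  have -> : P *m P = \sum_(F <- s) P *m F by exact: mulmx_sumr.
  rewrite [RHS]big_seq big_seq; apply: eq_bigr => F Fs.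
  rewrite (@sum_orth _ _ id) //; first by case: (mS' F Fs).
  by move=> F' F's F'F; apply: minidem_orth => //; exact: mS'.
have [SE EE E0 _] := mE.
have cap0 : (E :&: P)%MS = 0.
  apply/eqP; rewrite -submx0; apply/rV_subP => v.
  rewrite sub_capmx => /andP[/submxP[a ->] /submxP[b ab]].
  by rewrite -EE mulmxA ab -mulmxA PE mulmx0 sub0mx.
have sub : (E + P <= (E + P)%R)%MS.
  rewrite addsmx_sub; apply/andP; split; apply/submxP.
    by exists E; rewrite mulmxDr EE EP addr0.
  by exists P; rewrite mulmxDr PE PP add0r.
apply: (leq_trans _ (mxrankS sub)); rewrite mxrank_disjoint_sum // -addn1 addnC.
rewrite leq_add ?IH // lt0n mxrank_eq0; exact/eqP.
Qed.

(** Pairwise orthogonal nonzero idempotents have independent row spaces, so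
    there are at most n of them. *)
Lemma minidem_enum : exists2 s, uniq s & forall E, E \in s <-> minidem E.
Proof.
apply: contrapT => noS.
have H k : exists s, [/\ uniq s, size s = k & forall E, E \in s -> minidem E].
  elim: k => [|k [s [us sk mS]]]; first by exists [::].
  have [E mE Es] : exists2 E, minidem E & E \notin s.
    apply: contrapT => noE; apply: noS; exists s => // E; split; first exact: mS.
    by move=> mE; apply: contrapT => /negP Es; apply: noE; exists E.
  exists (E :: s); split=> /=; rewrite ?Es ?sk // => F.
  by rewrite in_cons => /orP[/eqP->|/mS].
have [s [us sk mS]] := H n.+1.
have := rank_sum_minidem us mS; rewrite sk => /leq_trans/(_ (rank_leq_row _)).
by rewrite ltnn.
Qed.

Variables (s : seq 'M[C]_n).
Hypothesis us : uniq s.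
Hypothesis sP : forall E, E \in s <-> minidem E.
Variables (U : 'M[C]_(n, r)) (V : 'M[C]_(r, n)).
Hypothesis mUV : minidem (U *m V).
Variable z : 'M[C]_r.
Hypothesis zu : z \in unitmx.
Hypothesis zG : forall T, SS T -> V *m T *m U <> 0 ->
  (z *m (V *m T *m U)) ^t* *m (z *m (V *m T *m U)) = z ^t* *m z.

Lemma enum_orth E F : E \in s -> F \in s -> E <> F -> E *m F = 0.
Proof. by move=> /sP mE /sP mF; exact: minidem_orth. Qed.

Lemma enum_idem E : E \in s -> E *m E = E.
Proof. by move=> /sP[]. Qed.

Lemma rank_mulr_le T E : E \in s -> (\rank (T *m E) <= r)%N.
Proof. by move=> /sP[_ _ _ rE]; exact: leq_trans (mxrankM_maxr _ _) rE. Qed.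

Lemma rank_mull_le T E : E \in s -> (\rank (E *m T) <= r)%N.
Proof. by move=> /sP[_ _ _ rE]; exact: leq_trans (mxrankM_maxl _ _) rE. Qed.

Lemma enum_left T E : SS T -> E \in s -> T *m E <> 0 ->
  exists2 F, F \in s & F *m T *m E = T *m E.
Proof.
move=> ST Es TE0; have [SE _ _ _] := (sP E).1 Es.
have [Y _ [mF FA]] := minidem_left (sgS ST SE) TE0 (rank_mulr_le T Es).
by exists (T *m E *m Y); [exact/sP|rewrite -mulmxA].
Qed.

Lemma enum_right T E : SS T -> E \in s -> E *m T <> 0 ->
  exists2 F, F \in s & E *m T *m F = E *m T.
Proof.
move=> ST Es ET0; have [SE _ _ _] := (sP E).1 Es.
have [Y _ [mF AF]] := minidem_right (sgS SE ST) ET0 (rank_mull_le T Es).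
by exists (Y *m (E *m T)) => //; exact/sP.
Qed.

(** The complement 1 - P of the sum kills every member of the form B U V,
    since the range of such a member is that of a minimal idempotent; by
    irreducibility 1 - P is zero. *)
Lemma enum_sum1 : \sum_(E <- s) E = 1%:M.
Proof.
set P := \sum_(E <- s) E; apply/eqP; rewrite eq_sym -subr_eq0; apply/eqP.
apply: contrapT => P0; have [_ _ E0 _] := mUV.
have Es : U *m V \in s by exact/sP.
have [B SB] := sep P0 E0; apply.
have [BE0|/eqP BE0] := eqVneq (B *m (U *m V)) 0; first by rewrite -mulmxA BE0 mulmx0.
have [F Fs FBE] := enum_left SB Es BE0.
have PF : P *m F = F.
  rewrite /P (@sum_orth _ _ id) //; first exact: enum_idem.
  by move=> F' F's; exact: enum_orth.
rewrite -mulmxA -FBE -mulmxA mulmxA mulmxBl mul1mx PF subrr mul0mx //.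
Qed.

Lemma enum_ext m (X X' : 'M[C]_(m, n)) :
  (forall E, E \in s -> X *m E = X' *m E) -> X = X'.
Proof.
move=> XE; rewrite -[X]mulmx1 -[X']mulmx1 -enum_sum1 !mulmx_sumr.
by rewrite big_seq [RHS]big_seq; exact: eq_bigr.
Qed.

(** The maps D E transport an inner product on the range of U V to the range of
    E.  By irreducibility some U V B E is nonzero, and the regularity of this
    member provides its left inverse on the range of E. *)
Lemma transport_maps : exists D : 'M[C]_n -> 'M[C]_n, forall E, E \in s ->
  [/\ SS (D E), U *m V *m D E = D E, D E *m E = D E &
      exists2 Y, SS Y & Y *m D E = E].
Proof.
suff /choice[D DP] : forall E, exists D : 'M[C]_n, E \in s ->
  [/\ SS D, U *m V *m D = D, D *m E = D & exists2 Y, SS Y & Y *m D = E].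
  by exists D.
move=> E; have [Es|nEs] := boolP (E \in s); last by exists 0.
have [SE EE E0 rE] := (sP E).1 Es; have [S1 E1E1 E10 _] := mUV.
have [B SB D0] := sep E10 E0; exists (U *m V *m B *m E) => _.
have SD : SS (U *m V *m B *m E) by apply: (sgS (sgS S1 SB) SE).
have [Y SY [mYD DYD]] := minidem_right SD D0 (rank_mulr_le _ Es).
have DE : U *m V *m B *m E *m E = U *m V *m B *m E by rewrite -mulmxA EE.
split=> //; first by rewrite !mulmxA -[U *m V *m U *m V]mulmxA E1E1.
exists Y => //; apply: minidem_eq => //.
move=> YDE0; apply: D0.
by rewrite -DE -{1}DYD -[LHS]mulmxA YDE0 mulmx0.
Qed.

(** The form H is the orthogonal sum of the transported forms.  If T maps the
    range of E onto that of F, then the transport maps of E and F differ on these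
    ranges by a corner matrix preserving z^* z, so T is isometric there ([step] in
    the proof).  Hence T^* H T = H Q, where Q is the sum of the minimal
    idempotents that T does not kill; with H = Z^* Z the initial projection of
    Z T Z^-1 is Z Q Z^-1. *)
Lemma similar_to_pisom : exists2 S : 'M[C]_n, S \in unitmx &
  forall T, SS T -> pisom (invmx S *m T *m S).
Proof.
have [D DP] := transport_maps; pose w E := z *m (V *m D E).
have UW E : E \in s -> U *m (V *m D E) = D E by move=> /DP[_ e _ _]; rewrite mulmxA.
have wE E : E \in s -> w E *m E = w E.
  by move=> /DP[_ _ e _]; rewrite /w -!mulmxA e.
have wF E F : E \in s -> F \in s -> E <> F -> w E *m F = 0.
  by move=> Es Fs EF; rewrite -wE // -mulmxA enum_orth // mulmx0.
have wx0 m E (x : 'M_(n, m)) : E \in s -> w E *m x = 0 -> E *m x = 0.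
  move=> Es wx; have [_ _ _ [Y _ YD]] := DP E Es.
  have Dx : D E *m x = 0.
    have zx : z *m (V *m D E *m x) = 0 by rewrite mulmxA.
    by rewrite -UW // -mulmxA -[V *m D E *m x](mulKmx zu) zx !mulmx0.
  by rewrite -YD -mulmxA Dx mulmx0.
pose H := \sum_(E <- s) (w E) ^t* *m w E.
have HE E : E \in s -> H *m E = (w E) ^t* *m w E.
  move=> Es; rewrite /H (@sum_orth _ _ (fun E => (w E) ^t* *m w E)) //.
    by rewrite -mulmxA wE.
  by move=> F Fs FE /=; rewrite -mulmxA wF // mulmx0.
have step T E F : SS T -> E \in s -> F \in s -> F *m T *m E = T *m E ->
    T *m E <> 0 -> (w F *m T) ^t* *m (w F *m T) = (w E) ^t* *m w E.
  move=> ST Es Fs FTE TE0; have [SDF _ DFF [YF _ YDF]] := DP F Fs.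
  have [SDE _ DEE [YE SYE YDE]] := DP E Es.
  have FT : F *m T = F *m T *m E.
    have FT0 : F *m T <> 0 by move=> FT0; apply: TE0; rewrite -FTE FT0 mul0mx.
    have [E' E's FTE'] := enum_right ST Fs FT0.
    suff <- : E' = E by [].
    apply: contrapT => ne; apply: TE0.
    by rewrite -FTE -FTE' -mulmxA (enum_orth E's Es ne) mulmx0.
  (* The corner matrix comparing the two transport maps. *)
  pose T' := D F *m T *m YE.
  have ST' : SS T' by apply: sgS => //; exact: sgS.
  have VDT : V *m D F *m T = V *m T' *m U *m (V *m D E).
    have -> : V *m T' *m U *m (V *m D E) = V *m T' *m D E by rewrite -mulmxA UW.
    by rewrite /T' -!mulmxA YDE -DFF -!mulmxA [F *m (T *m E)]mulmxA -FT.
  have g0 : V *m T' *m U <> 0.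
    move=> g0; apply: TE0; rewrite -FTE; suff -> : F *m T = 0 by rewrite mul0mx.
    by apply: wx0 => //; rewrite /w -mulmxA VDT g0 mul0mx mulmx0.
  have wFT : w F *m T = z *m (V *m T' *m U) *m (V *m D E).
    by rewrite /w -!mulmxA; congr (z *m _); rewrite mulmxA VDT -!mulmxA.
  have Gz := zG ST' g0.
  rewrite wFT adjmxM mulmxA -[(V *m D E) ^t* *m _ *m _]mulmxA Gz.
  by rewrite /w [(z *m _) ^t*]adjmxM !mulmxA.
have Hh : H ^t* = H.
  rewrite /H raddf_sum /= map_mx_sum; apply: eq_bigr => E _.
  by rewrite adjmxM trmxCK.
have xHx m (x : 'M[C]_(n, m)) :
    x ^t* *m H *m x = \sum_(E <- s) (w E *m x) ^t* *m (w E *m x).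
  rewrite mulmx_sumr mulmx_suml; apply: eq_bigr => E _.
  by rewrite adjmxM !mulmxA.
have H0 (x : 'cV[C]_n) : 0 <= (x ^t* *m H *m x) 0 0.
  rewrite xHx summxE sumr_ge0 // => E _; exact: sqn_ge0.
have [Z ZZ] := gram_factor Hh H0.
have Zu : Z \in unitmx.
  rewrite -unitmx_tr -row_free_unit -kermx_eq0; apply/eqP.
  set k := kermx _; have Zk : Z *m k^T = 0.
    by rewrite -[Z]trmxK -trmx_mul mulmx_ker trmx0.
  apply: trmx_inj; rewrite trmx0 -[k^T]mul1mx -enum_sum1 mulmx_suml big_seq.
  apply: big1 => E Es; apply: wx0 => //; apply/matrixP => i j.
  have := congr1 (fun A => A j j) (xHx _ k^T); rewrite -ZZ.
  rewrite -!mulmxA Zk !mulmx0 mxE summxE => /esym/eqP.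
  under eq_bigr do rewrite adjmx_mul_diag.
  rewrite psumr_eq0 => [|F _]; last by apply: sumr_ge0 => l _; exact: exprn_ge0.
  move=> /allP/(_ E Es)/=; rewrite psumr_eq0 => [|l _]; last exact: exprn_ge0.
  move=> /allP/(_ i (mem_index_enum _)); rewrite expf_eq0 normr_eq0 /= => /eqP wk.
  by rewrite [RHS]mxE -wk /w !mulmxA.
exists (invmx Z); first by rewrite unitmx_inv.
move=> T ST; rewrite invmxK; apply: adj_mul_idem.
pose q E := if T *m E == 0 then 0 else E.
pose Q := \sum_(E <- s) q E.
have QE E : E \in s -> Q *m E = q E.
  move=> Es; rewrite /Q (@sum_orth _ _ q) //.
    by rewrite /q; case: eqP => _; rewrite ?mul0mx // enum_idem.
  by move=> F Fs FE; rewrite /q; case: eqP => _; rewrite ?mul0mx // enum_orth.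
have QQ : Q *m Q = Q.
  apply: enum_ext => E Es; rewrite -mulmxA (QE E Es).
  have [qE|qE] : q E = 0 \/ q E = E by rewrite /q; case: eqP; [left|right].
    by rewrite qE mulmx0.
  by rewrite qE (QE E Es) qE.
have THT : T ^t* *m H *m T = H *m Q.
  apply: enum_ext => E Es; rewrite -[H *m Q *m E]mulmxA QE // /q.
  case: eqP => TE0; first by rewrite -mulmxA TE0 !mulmx0.
  have [F Fs FTE] := enum_left ST Es TE0.
  have FT : w F *m T *m E = w F *m T.
    have FT0 : F *m T <> 0 by move=> FT0; apply: TE0; rewrite -FTE FT0 mul0mx.
    have [E' E's FTE'] := enum_right ST Fs FT0.
    have -> : E = E'.
      apply/esym; apply: contrapT => ne; apply: TE0.
      by rewrite -FTE -FTE' -mulmxA (enum_orth E's Es ne) mulmx0.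
    by rewrite -(wE F Fs) -!mulmxA [F *m (T *m E')]mulmxA FTE'.
  have -> : T ^t* *m H *m T *m E = T ^t* *m (H *m F) *m (T *m E).
    by rewrite -!mulmxA [F *m (T *m E)]mulmxA FTE.
  rewrite !HE // -(step T E F) // -[X in _ = _ *m X]FT.
  by rewrite adjmxM -!mulmxA.
have e : (Z *m T *m invmx Z) ^t* *m (Z *m T *m invmx Z) = Z *m Q *m invmx Z.
  rewrite !adjmxM !mulmxA -[_ *m Z ^t* *m Z]mulmxA ZZ.
  rewrite -[_ *m H *m T]mulmxA -[_ *m _ *m (H *m T)]mulmxA [T ^t* *m _]mulmxA THT.
  rewrite -ZZ !mulmxA; congr (_ *m _ *m _).
  by rewrite -adjmxM mulmxV // trmx1 map_mx1 mul1mx.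
by rewrite e !mulmxA mulmxKV // -[Z *m Q *m Q]mulmxA QQ.
Qed.
End Brandt.

(** * Members of minimal rank: compactness *)

Section MinimalRank.
Variables (R : realType) (n : nat).
Notation C := R[i].
Variables (U : set_system nat) (UF : UltraFilter U).
Hypothesis Uoo : \oo `<=` U.

Lemma bounded_powers_le1 (x : R) b : 0 <= x -> (forall k, x ^+ k.+1 <= b) -> x <= 1.
Proof.
move=> x0 xb; rewrite leNgt; apply/negP => x1.
have xp : 0 < x by exact: lt_trans x1.
have lim : slim U (fun k => x^-1 ^+ k) 0.
  have xV1 : `|x^-1| < 1 by rewrite ger0_norm ?invr_ge0 // invf_lt1.
  by apply: slim_of_cvg => //; exact: cvg_expr.
have limb := slimM UF (slim_cst UF b) lim.
have := slim_le UF (slim_cst UF (1 : R)) limb; rewrite mulr0.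
suff h k : 1 <= b * x^-1 ^+ k by move=> /(_ h); rewrite ler10.
rewrite exprVn ler_pdivlMr ?exprn_gt0 // mul1r (le_trans _ (xb k)) // exprS.
by rewrite ler_peMl ?exprn_ge0 // ltW.
Qed.

Variable SS : set 'M[C]_n.
Hypothesis sgS : matrix_semigroup SS.
Hypothesis limS : forall (A : nat -> 'M[C]_n) L,
  (forall k, SS (A k)) -> mlim U A L -> SS L.
Hypothesis sep : forall X Z : 'M[C]_n, X <> 0 -> Z <> 0 ->
  exists2 B, SS B & X *m B *m Z <> 0.
Variable c : C.
Hypothesis bS : bibounded SS c.
Variable r : nat.
Hypothesis rmin : forall A, SS A -> A <> 0 -> (r <= \rank A)%N.

Lemma semigroup_mlim_exists (A : nat -> 'M[C]_n) :
  (forall k, SS (A k)) -> exists2 L, SS L & mlim U A L.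
Proof.
move=> SA; have [k i j|L AL] := @mlim_exists U UF R n n A c.
  by apply: le_trans (entry_le_mxnorm1 _ _ _) _; case: (bS (SA k)).
by exists L => //; exact: limS AL.
Qed.

Section Corner.
Variables (A : 'M[C]_n) (P : 'M[C]_(n, r)) (Q : 'M[C]_(r, n)).
Hypothesis SA : SS A.
Hypothesis APQ : A = P *m Q.
Hypothesis Pf : row_full P.
Hypothesis Qf : row_free Q.

Lemma corner_sandwich T : A *m T *m A = P *m (Q *m T *m P) *m Q.
Proof. by rewrite APQ !mulmxA. Qed.

(** Q T P has the rank of the member A T A. *)
Lemma corner_unit T : SS T -> Q *m T *m P <> 0 -> Q *m T *m P \in unitmx.
Proof.
move=> ST G0; rewrite -row_free_unit -row_leq_rank.
rewrite -(mxrank_sandwich (Q *m T *m P) Pf Qf) -corner_sandwich rmin //.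
  by apply: sgS => //; exact: sgS.
by rewrite corner_sandwich => /(sandwich_eq0 Pf Qf).
Qed.

(** The words B A B ... A B with k+1 letters B, whose corners are the powers
    of the corner of B. *)
Definition corner_pow B k := iter k (fun T => B *m A *m T) B.

Lemma corner_pow_mem B k : SS B -> SS (corner_pow B k).
Proof.
by move=> SB; elim: k => [//|k IH] /=; apply: sgS IH; exact: sgS.
Qed.

Lemma corner_powE B k : Q *m corner_pow B k *m P = mxpow (Q *m B *m P) k.
Proof.
elim: k => [//|k IH]; rewrite mxpowS -IH /= -/(corner_pow B k).
by rewrite APQ !mulmxA.
Qed.

(** Let M be an invertible corner, and let the corner of L be a limit of its
    powers; it is invertible by the lower bound on norms.  For l > k the power
    M^l is a corner times M^k; letting l grow along the ultrafilter, the corner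
    of L is the corner of a member X k times M^k.  Letting k grow, it is the
    corner of a limit Y of the X k times itself, so the corner of Y is 1. *)
Lemma corner_one : A <> 0 -> exists2 T, SS T & Q *m T *m P = 1%:M.
Proof.
move=> A0; have [B SB ABA0] := sep A0 A0.
pose M := Q *m B *m P; pose T := corner_pow B.
have ST k : SS (T k) by exact: corner_pow_mem.
have TE k : Q *m T k *m P = mxpow M k by exact: corner_powE.
have Mu : M \in unitmx.
  apply: corner_unit => // M0; apply: ABA0.
  by rewrite corner_sandwich M0 mulmx0 mul0mx.
have ATA k : A *m T k *m A <> 0.
  move=> e; apply: A0; apply/eqP; rewrite -mxrank_eq0.
  have := congr1 mxrank e; rewrite corner_sandwich mxrank_sandwich // TE mxrank0.
  rewrite mxrank_unit ?mxpow_unit // => r0.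
  by rewrite -leqn0 APQ -r0 (leq_trans (mxrankM_maxl _ _)) ?rank_leq_col.
have [L SL TL] := semigroup_mlim_exists ST.
have corner_lim (X : nat -> 'M[C]_n) Y : mlim U X Y ->
    mlim U (fun k => Q *m X k *m P) (Q *m Y *m P).
  by move=> XY; apply: mlimM (mlim_cst UF P) => //; apply: mlimM => //; exact: mlim_cst.
have ML : mlim U (mxpow M) (Q *m L *m P) by apply: mlim_ext (corner_lim _ _ TL).
have Lu : Q *m L *m P \in unitmx.
  apply: corner_unit => // L0.
  have lim : mlim U (fun k => A *m T k *m A) (A *m L *m A).
    by apply: mlimM (mlim_cst UF A) => //; apply: mlimM => //; exact: mlim_cst.
  have := slim_le UF (slim_cst UF 1) (slimM UF (slim_cst UF c) (slim_mxnorm1 UF lim)).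
  rewrite [A *m L *m A]corner_sandwich L0 mulmx0 mul0mx mxnorm1_0 mulr0 ler10 => le10.
  by suff : false by []; apply: le10 => k; apply: (bS _).2 => //; do 2?apply: sgS.
have /choice[X XP] : forall k, exists X, SS X /\
    Q *m X *m P *m mxpow M k = Q *m L *m P.
  move=> k; have STk l : SS (T (l - k.+1)%N) by exact: ST.
  have [X SX TX] := semigroup_mlim_exists STk; exists X; split=> //.
  have l1 := mlimM UF (corner_lim _ _ TX) (mlim_cst UF (mxpow M k)).
  apply: (mlim_uniq UF l1).
  apply: mlim_near ML; apply: Uoo; exists k.+1 => // l /= kl.
  by rewrite TE mxpowD -addnS subnK.
have SX k : SS (X k) by case: (XP k).
have [Y SY XY] := semigroup_mlim_exists SX; exists Y => //.
have l1 := mlimM UF (corner_lim _ _ XY) ML.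
have l2 : mlim U (fun k => Q *m X k *m P *m mxpow M k) (Q *m L *m P).
  by apply: mlim_ext (mlim_cst UF _) => k; case: (XP k).
have e := mlim_uniq UF l1 l2.
by rewrite -[LHS](mulmxK Lu) e mulmxV.
Qed.

End Corner.

(** Regularity in the sense of semigroup theory: A Y and Y A are then
    idempotents with the range and the kernel of A. *)
Lemma regular A : SS A -> A <> 0 -> (\rank A <= r)%N ->
  exists2 Y, SS Y & A *m Y *m A = A.
Proof.
move=> SA A0 rA; have [r' [P [Q [APQ r'E Pf Qf]]]] := full_rank_factor A.
have rE : r' = r by apply/eqP; rewrite eqn_leq r'E rA rmin.
clear r'E; subst r'; have [Y SY QYP] := corner_one SA APQ Pf Qf A0.
by exists Y; rewrite // (corner_sandwich APQ) QYP mulmx1.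
Qed.

Section CornerGroup.
Variables (A : 'M[C]_n) (P : 'M[C]_(n, r)) (Q : 'M[C]_(r, n)).
Hypothesis SA : SS A.
Hypothesis APQ : A = P *m Q.
Hypothesis Pf : row_full P.
Hypothesis Qf : row_free Q.
Hypothesis A0 : A <> 0.

Lemma corner_inv T : SS T -> Q *m T *m P \in unitmx ->
  exists2 T', SS T' & (Q *m T' *m P) *m (Q *m T *m P) = 1%:M.
Proof.
move=> ST Tu; have SATA : SS (A *m T *m A) by apply: sgS => //; exact: sgS.
have rATA : \rank (A *m T *m A) = r.
  by rewrite (corner_sandwich APQ) mxrank_sandwich // mxrank_unit.
have r0 : (0 < r)%N.
  rewrite lt0n; apply/eqP => r0; apply: A0; apply/eqP; rewrite -mxrank_eq0.
  by rewrite -leqn0 APQ -r0 (leq_trans (mxrankM_maxl _ _)) ?rank_leq_col.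
have ATA0 : A *m T *m A <> 0.
  by move=> e; move: r0; rewrite -rATA e mxrank0.
have [Y SY] := regular SATA ATA0 (eq_leq rATA).
rewrite (corner_sandwich APQ); set g := Q *m T *m P in Tu *.
have -> : P *m g *m Q *m Y *m (P *m g *m Q) = P *m (g *m (Q *m Y *m P) *m g) *m Q.
  by rewrite !mulmxA.
move=> /(sandwich_inj Pf Qf) e; exists Y => //.
by apply: (can_inj (mulKmx Tu)); rewrite mulmx1 mulmxA.
Qed.

(** The powers of a corner are corners, hence bounded. *)
Lemma corner_det_le1 T : SS T -> Q *m T *m P \in unitmx -> `|\det (Q *m T *m P)| <= 1.
Proof.
move=> ST Tu; have [b bP] := @det_bound R r (mxnorm1 Q * c * mxnorm1 P).
have pw k : `|\det (Q *m T *m P)| ^+ k.+1 <= b.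
  rewrite -normrX -det_mxpow -(corner_powE APQ); apply: bP => i j.
  apply: le_trans (entry_le_mxnorm1 _ _ _) _; apply: le_trans (mxnorm1M _ _) _.
  rewrite ler_wpM2r ?mxnorm1_ge0 //; apply: le_trans (mxnorm1M _ _) _.
  by rewrite ler_wpM2l ?mxnorm1_ge0 //; case: (bS (corner_pow_mem SA k ST)).
set d := `|_| in pw *; have dE : (Re d)%:C = d by apply: RRe_real; exact: normr_real.
have d0 : 0 <= d by exact: normr_ge0.
have bE : (Re b)%:C = b.
  by rewrite RRe_real // ger0_real // (le_trans _ (pw 0%N)) // exprn_ge0.
rewrite -dE -[1]/(1%:C) lecR; apply: (@bounded_powers_le1 _ (Re b)).
  by rewrite -lecR dE.
by move=> k; rewrite -lecR rmorphXn /= dE bE.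
Qed.

(** The invertible corners form a bounded group, so their determinants have
    modulus one. *)
Lemma corner_unitarizable : exists2 z : 'M[C]_r, z \in unitmx &
  forall T, SS T -> Q *m T *m P <> 0 ->
  (z *m (Q *m T *m P)) ^t* *m (z *m (Q *m T *m P)) = z ^t* *m z.
Proof.
pose G := [set g : 'M[C]_r | g \in unitmx /\ exists2 T, SS T & g = Q *m T *m P].
have GM g h : G g -> G h -> G (g *m h).
  move=> [gu [T ST gT]] [hu [T' ST' hT']]; split; first by rewrite unitmx_mul gu.
  exists (T *m A *m T'); first by apply: sgS => //; exact: sgS.
  by rewrite gT hT' APQ !mulmxA.
have G1 : G 1%:M.
  split; first exact: unitmx1.
  by have [T ST TE] := corner_one SA APQ Pf Qf A0; exists T.
have Gc g : G g -> mxnorm1 g <= mxnorm1 Q * c * mxnorm1 P.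
  move=> [_ [T ST ->]]; apply: le_trans (mxnorm1M _ _) _.
  rewrite ler_wpM2r ?mxnorm1_ge0 //; apply: le_trans (mxnorm1M _ _) _.
  by rewrite ler_wpM2l ?mxnorm1_ge0 //; case: (bS ST).
have Gdet g : G g -> `|\det g| = 1.
  move=> [gu [T ST gT]]; rewrite gT in gu *.
  have [T' ST' T'T] := corner_inv ST gu.
  have T'u : Q *m T' *m P \in unitmx by case/mulmx1_unit: T'T.
  apply/le_anti; rewrite corner_det_le1 //=.
  have := congr1 determinant T'T; rewrite det_mulmx det1 => /(congr1 Num.norm).
  rewrite normrM normr1 => <-; rewrite ler_piMl //; exact: corner_det_le1.
have [z zu zG] := unitarizable UF Uoo GM G1 Gc Gdet.
exists z => // T ST T0; apply: zG; split; first exact: (corner_unit SA APQ Pf Qf ST T0).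
by exists T.
Qed.
End CornerGroup.

Hypothesis idemC : idempotents_commute SS.

Lemma minimal_rank_similar E : SS E -> E *m E = E -> E <> 0 -> (\rank E <= r)%N ->
  exists2 S : 'M[C]_n, S \in unitmx & forall T, SS T -> pisom (invmx S *m T *m S).
Proof.
move=> SE EE E0 rE; have [r' [P [Q [EPQ r'E Pf Qf]]]] := full_rank_factor E.
have r'r : r' = r by apply/eqP; rewrite eqn_leq r'E rE rmin.
clear r'E; subst r'.
have [z zu zG] := corner_unitarizable SE EPQ Pf Qf E0.
have cS P' Q' : SS P' -> SS Q' -> P' *m P' = P' -> Q' *m Q' = Q' ->
  P' *m Q' = Q' *m P' by move=> SP SQ; exact: idemC.
have mE : minidem SS r (P *m Q) by rewrite -EPQ.
have [s us sP] := minidem_enum sgS cS rmin.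
exact: (similar_to_pisom sgS sep cS rmin regular us sP mE zu zG).
Qed.
End MinimalRank.

(** * The equivalence *)

Section Bounded.
Variables (R : realType) (n : nat) (SS : set 'M[R[i]]_n).

(** A nonzero member of least rank yields the minimal idempotent from which
    the corner group is formed. *)
Lemma bibounded_similar c : matrix_semigroup SS -> norm_closed SS ->
  irreducible SS -> idempotents_commute SS -> bibounded SS c ->
  exists2 S : 'M[R[i]]_n, S \in unitmx &
    forall T, SS T -> partial_isometry (invmx S *m T *m S).
Proof.
move=> sgS clS irrS cS bS.
have [[T0 ST0 T00]|no] := pselect (exists2 T, SS T & T <> 0); last first.
  exists 1%:M; first exact: unitmx1.
  move=> T ST; have -> : T = 0 by apply: contrapT => T0; apply: no; exists T.
  by apply/partial_isometryP; rewrite /pisom mulmx0 !mul0mx.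
have [U [UF Uoo]] := ultraFilterLemma eventually_filter.
have sep (X Z : 'M[R[i]]_n) : X <> 0 -> Z <> 0 -> exists2 B, SS B & X *m B *m Z <> 0.
  by move=> X0 Z0; apply: irreducible_sep => //; exists T0.
pose hasrank k := `[< exists T, [/\ SS T, T <> 0 & \rank T = k] >].
have exr : exists k, hasrank k by exists (\rank T0); apply/asboolP; exists T0.
case: (ex_minnP exr) => r /asboolP[A [SA A0 rA]] rminP.
have rmin T : SS T -> T <> 0 -> (r <= \rank T)%N.
  by move=> ST TN0; apply: rminP; apply/asboolP; exists T.
have limS := norm_closed_mlim UF clS.
have [Y SY AYA] := regular UF Uoo sgS limS sep bS rmin SA A0 (eq_leq rA).
have [|||S Su SP] := @minimal_rank_similar R n U UF Uoo SS sgS limS sep c bS r rmin cS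
  (A *m Y) (sgS _ _ SA SY).
- by rewrite mulmxA AYA.
- by move=> AY0; apply: A0; rewrite -AYA AY0 mul0mx.
- by rewrite -rA mxrankM_maxl.
- by exists S => // T ST; apply/partial_isometryP; exact: SP.
Qed.
End Bounded.

Section SimilarToPartialIsometries.
Variables (R : realType) (n : nat) (SS : set 'M[R[i]]_n) (S : 'M[R[i]]_n).
Hypothesis sgS : matrix_semigroup SS.
Hypothesis Su : S \in unitmx.
Hypothesis piS : forall T, SS T -> partial_isometry (invmx S *m T *m S).

Lemma similar_pisom T : SS T -> pisom (invmx S *m T *m S).
Proof. by move=> /piS/partial_isometryP. Qed.

Lemma similar_mulmx A B : invmx S *m (A *m B) *m S = (invmx S *m A *m S) *m (invmx S *m B *m S).
Proof. by rewrite !mulmxA mulmxK. Qed.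

Lemma similar_idempotents_commute : idempotents_commute SS.
Proof.
move=> P Q SP SQ PP QQ.
have idem T : T *m T = T -> (invmx S *m T *m S) *m (invmx S *m T *m S) = invmx S *m T *m S.
  by move=> TT; rewrite -similar_mulmx TT.
have sa T : SS T -> T *m T = T -> (invmx S *m T *m S) ^t* = invmx S *m T *m S.
  by move=> ST TT; apply: pisom_idempotent; [exact: idem|exact: similar_pisom].
have := pisom_projections_commute (idem P PP) (sa P SP PP) (idem Q QQ) (sa Q SQ QQ).
rewrite -!similar_mulmx => /(_ (similar_pisom (sgS SP SQ))) /(can_inj (mulmxK Su)).
by move/(can_inj (mulKVmx Su)).
Qed.

Lemma similar_spectrum T z : SS T -> eigenvalue T z -> z <> 0 -> `|z| = 1.
Proof.
move=> ST /eigenvalueP[v vT v0] z0.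
apply: (@power_pisom_eigenvalue _ _ (invmx S *m T *m S) (v *m S)) => //.
- move=> k; have -> : mxpow (invmx S *m T *m S) k = invmx S *m mxpow T k *m S.
    by elim: k => [//|k IH]; rewrite !mxpowS similar_mulmx -IH.
  by apply: similar_pisom; elim: k => [//|k IH]; exact: sgS.
- by rewrite !mulmxA mulmxK // vT scalemxAl.
- move=> vS0; move: v0; rewrite -[v](mulmxK Su) vS0 mul0mx eqxx //.
Qed.
End SimilarToPartialIsometries.

Theorem theorem2p5 (R : realType) (n : nat) (n_ge1 : (1 <= n)%N)
    (SS : set 'M[R[i]]_n)
    (SS_semigroup : matrix_semigroup SS)
    (SS_closed : norm_closed SS)
    (SS_irreducible : irreducible SS) :
  let cond_i :=
    exists2 S : 'M[R[i]]_n, S \in unitmx &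
      forall T, SS T -> partial_isometry (invmx S *m T *m S) in
  let cond_ii :=
    idempotents_commute SS /\
    forall T, SS T -> spectrum T `<=` [set 0] `|` [set z | `|z| = 1] in
  let cond_iii :=
    idempotents_commute SS /\
    exists c1 c2 : R, [/\ 0 < c1, 0 < c2 &
      forall T, SS T -> T <> 0 -> c1 <= opnorm T <= c2] in
  (cond_i <-> cond_ii) /\ (cond_ii <-> cond_iii).
Proof.
move=> cond_i cond_ii cond_iii.
have i_ii : cond_i -> cond_ii.
  move=> [S Su piS]; split; first exact: similar_idempotents_commute piS.
  move=> T ST z Tz; have [z0|/eqP z0] := eqVneq z 0; [by left|right].
  exact: (similar_spectrum SS_semigroup Su piS ST Tz z0).
have ii_iii : cond_ii -> cond_iii.
  move=> [cS spS]; split=> //.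
  have [[T0 ST0 T00]|no] := pselect (exists2 T, SS T & T <> 0); last first.
    by exists 1, 1; split=> // T ST T0; case: no; exists T.
  have [U [UF Uoo]] := ultraFilterLemma eventually_filter.
  have sep (X Z : 'M[R[i]]_n) : X <> 0 -> Z <> 0 -> exists2 B, SS B & X *m B *m Z <> 0.
    by move=> X0 Z0; apply: irreducible_sep => //; exists T0.
  have sp1 T z : SS T -> eigenvalue T z -> z <> 0 -> `|z| = 1.
    by move=> ST Tz z0; have [|//] := spS T ST z Tz.
  have [c bS] := spectral_bibounded UF Uoo SS_semigroup sep sp1.
  exact: bibounded_opnorm_bounds bS.
have iii_i : cond_iii -> cond_i.
  move=> [cS [c1 [c2 [c10 c20 Sc]]]].
  have [c bS] := opnorm_bounds_bibounded c10 c20 Sc.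
  exact: bibounded_similar bS.
by split; split=> [?|?]; auto.
Qed.
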